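(* Every torus knot type is realized by a smooth closed elastic rod centerline. That is, for every torus knot type in $\mathbb{R}^3$ there is a smooth closed curve in $\mathbb{R}^3$ which is an elastic rod centerline and has that knot type.
   Context: For a smooth unit-speed curve $\gamma(s)$ in $\mathbb{R}^3$ let $T,N,B$ be its Frenet frame with curvature $\kappa$ and torsion $\tau$: $\gamma'=T$, $T'=\kappa N$, $N'=-\kappa T+\tau B$, $B'=-\tau N$. The curve $\gamma$ is called an elastic rod centerline if, for some real constants $\lambda_1,\lambda_2,\lambda_3$ with $\lambda_3\ne 0$, it is an extremal (critical curve, with respect to variations keeping endpoints fixed to second order on each arc) of the functional $$\mathcal{F}[\gamma]=\lambda_1\int_\gamma ds+\lambda_2\int_\gamma\tau\,ds+\lambda_3\int_\gamma\kappa^2\,ds .$$ In terms of the Euler–Lagrange equations, this means that for some real constants $a_1,a_2$ the vector field $$J=\tfrac12(\kappa^2-2a_1)T+\kappa_s N+\kappa(\tau-a_2)B$$ is constant along $\gamma$ (equivalently, $T''+(\tfrac32\kappa^2-a_1)T-a_2\,T\times T'$ is constant, which also makes sense at inflection points). A torus knot type is the knot type of a simple closed curve on a standard embedded torus of revolution which winds $m$ times around the axis of revolution and $n$ times around the meridian direction, with $m,n$ nonzero relatively prime integers (signs allowed, so mirror images are included). *)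

(* Defs.v *)
From Stdlib Require Import Reals ZArith.
From Coquelicot Require Import Coquelicot.
Open Scope R_scope.

Definition R3 : Type := (R * R * R)%type.

Definition mk3 (x y z : R) : R3 := (x, y, z).
Definition cx (u : R3) : R := fst (fst u).
Definition cy (u : R3) : R := snd (fst u).
Definition cz (u : R3) : R := snd u.

Definition dot (u v : R3) : R := cx u * cx v + cy u * cy v + cz u * cz v.

Definition cross (u v : R3) : R3 :=
  mk3 (cy u * cz v - cz u * cy v)
      (cz u * cx v - cx u * cz v)
      (cx u * cy v - cy u * cx v).

Definition add3 (u v : R3) : R3 := mk3 (cx u + cx v) (cy u + cy v) (cz u + cz v).
Definition scal3 (k : R) (u : R3) : R3 := mk3 (k * cx u) (k * cy u) (k * cz u).

Definition smooth (c : R -> R3) : Prop :=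
  forall (k : nat) (s : R),
    ex_derive_n (fun t => cx (c t)) k s /\
    ex_derive_n (fun t => cy (c t)) k s /\
    ex_derive_n (fun t => cz (c t)) k s.

(* [Derive] is total, so this is the derivative only for differentiable [c]. *)
Definition Derive3 (c : R -> R3) (s : R) : R3 :=
  mk3 (Derive (fun t => cx (c t)) s)
      (Derive (fun t => cy (c t)) s)
      (Derive (fun t => cz (c t)) s).

Definition unit_speed (c : R -> R3) : Prop :=
  forall s : R, dot (Derive3 c s) (Derive3 c s) = 1.

(* A closed curve is a periodic map on R; [L] is its length when [c] has unit
   speed. *)
Definition simple_closed (c : R -> R3) (L : R) : Prop :=
  0 < L /\
  (forall s : R, c (s + L) = c s) /\
  (forall s t : R, 0 <= s < L -> 0 <= t < L -> c s = c t -> s = t).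

(* T'' + (3/2 kappa^2 - a1) T - a2 T x T' with T = c' and kappa^2 = |T'|^2.
   Where kappa <> 0, the Frenet equations turn it into
     J = 1/2 (kappa^2 - 2 a1) T + kappa_s N + kappa (tau - a2) B;
   the present form needs no Frenet frame, so inflection points are allowed. *)
Definition rod_field (a1 a2 : R) (c : R -> R3) (s : R) : R3 :=
  let T := Derive3 c in
  let T' := Derive3 T in
  let T'' := Derive3 T' in
  add3 (T'' s)
    (add3 (scal3 (3 / 2 * dot (T' s) (T' s) - a1) (T s))
          (scal3 (- a2) (cross (T s) (T' s)))).

(* Euler-Lagrange equations of
     lambda1 int ds + lambda2 int tau ds + lambda3 int kappa^2 ds, lambda3 <> 0,
   for a smooth unit-speed curve, in their once-integrated form, with
   a1 = lambda1 / (2 lambda3) and a2 = lambda2 / (2 lambda3). *)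
Definition elastic_rod_centerline (c : R -> R3) : Prop :=
  smooth c /\ unit_speed c /\
  exists a1 a2 : R, exists J : R3, forall s : R, rod_field a1 a2 c s = J.

Definition image (c : R -> R3) : R3 -> Prop := fun p => exists t : R, c t = p.

Definition homeomorphism (f : R3 -> R3) : Prop :=
  (forall p : R3, continuous f p) /\
  exists g : R3 -> R3,
    (forall p : R3, continuous g p) /\
    (forall p : R3, g (f p) = p) /\
    (forall p : R3, f (g p) = p).

(* Only the times in [0, 1] matter: asking for continuity on all of R x R3
   loses no generality, since an isotopy over [0, 1] can be extended by its
   end maps. *)
Definition ambient_isotopy (H : R -> R3 -> R3) : Prop :=
  (forall (t : R) (p : R3),
     continuous (fun q : R * R3 => H (fst q) (snd q)) (t, p)) /\
  (forall t : R, 0 <= t <= 1 -> homeomorphism (H t)) /\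
  (forall p : R3, H 0 p = p).

Definition same_knot_type (K K' : R3 -> Prop) : Prop :=
  exists H : R -> R3 -> R3,
    ambient_isotopy H /\
    forall q : R3, K' q <-> exists p : R3, K p /\ H 1 p = q.

(* On the torus of revolution about the z-axis with core radius [a] and tube
   radius [r], the curve winding [m] times around the axis and [n] times in the
   meridian direction, both at constant angular speed.  For coprime [m] and [n]
   it is simple of period 2 PI, and every simple closed curve on the torus with
   these winding numbers has its knot type. *)
Definition torus_curve (a r : R) (m n : Z) (t : R) : R3 :=
  mk3 ((a + r * cos (IZR n * t)) * cos (IZR m * t))
      ((a + r * cos (IZR n * t)) * sin (IZR m * t))
      (r * sin (IZR n * t)).

(* Main.v *)
Require Import Defs.
From Stdlib Require Import Reals ZArith Lra Lia ClassicalEpsilon FunctionalExtensionality.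
From Coquelicot Require Import Coquelicot.
Open Scope R_scope.

(* A unit-speed curve is a rod centerline when T' = M x T with
   M = gamma x J + A, J and A constant and parallel to the z-axis. In a frame
   rotating about the axis, the projection to the xy-plane then moves in a
   central quartic potential, so that the rod is explicit up to quadratures: it
   winds on a torus of revolution, and closes up under one condition on the mean
   height and one on the angle swept per meridian turn. Near a circle around the
   axis that angle takes all values strictly between 0 and 2 PI, by the
   intermediate value theorem. This gives a rod with m turns around the axis
   and n meridian turns whenever 0 < |m| < |n|.
   To move knots, a curve is displaced by the identity plus a small Lipschitz
   field (an extension of the displacement of the curve), which is a
   homeomorphism; by compactness and connectedness of [0, 1] a C^1 family of
   embedded closed curves has constant knot type. Curves with the same winding
   numbers on different tori of revolution are joined by linear interpolation.
   The case |m| > |n| is reduced to the previous one by rotating the Clifford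
   torus in the 3-sphere so as to exchange its two factors. *)

(** * Ambient isotopies *)

(** The magnetic form is the rod equation integrated once more: [T x J] is the derivative of
    [T x T' + a2 T], so this vector is [gamma x J + A], and its cross product with [T] is [T']. For
    [J <> 0], a choice of axis makes [A] parallel to [J]. The squared distance to the axis then
    solves [u'^2 = cubic in u], so the closing conditions are elliptic integrals. They are never
    evaluated: only their continuity enters, and their values when two roots of the cubic merge and
    the rod becomes a circle. There half a meridian turn sweeps [PI * sqrt (sg / (1 + sg))], which
    exhausts the interval from 0 to [PI]; hence the restriction to slopes [0 < |m/n| < 1]. The value
    [|m/n| = 1] is an excluded end of this range; it belongs to the unknot, which is treated as a
    curve with windings [1] or [-1] and [2] instead. The stages of an ambient isotopy only have to
    be homeomorphisms. A Lipschitz extension of the displacement of the curve therefore suffices,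
    with neither flows nor tubular neighbourhoods; what it requires is a chord-arc bound. *)

Definition dist1 (p q : R3) : R :=
  Rabs (cx p - cx q) + Rabs (cy p - cy q) + Rabs (cz p - cz q).

Lemma R3_eq (p q : R3) : cx p = cx q -> cy p = cy q -> cz p = cz q -> p = q.
Proof.
  destruct p as [[x y] z], q as [[x' y'] z']; cbn; intros; subst; reflexivity.
Qed.

Lemma dist1_ge0 (p q : R3) : 0 <= dist1 p q.
Proof. unfold dist1; repeat apply Rplus_le_le_0_compat; apply Rabs_pos. Qed.

Lemma dist1_sym (p q : R3) : dist1 p q = dist1 q p.
Proof.
  unfold dist1; rewrite (Rabs_minus_sym (cx p)), (Rabs_minus_sym (cy p)),
    (Rabs_minus_sym (cz p)); reflexivity.
Qed.

Lemma dist1_triangle (p q r : R3) : dist1 p r <= dist1 p q + dist1 q r.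
Proof.
  unfold dist1.
  assert (H : forall a b c : R, Rabs (a - c) <= Rabs (a - b) + Rabs (b - c)).
  { intros a b c; replace (a - c) with ((a - b) + (b - c)) by ring; apply Rabs_triang. }
  pose proof (H (cx p) (cx q) (cx r)); pose proof (H (cy p) (cy q) (cy r));
  pose proof (H (cz p) (cz q) (cz r)); lra.
Qed.

Lemma dist1_eq0 (p q : R3) : dist1 p q <= 0 -> p = q.
Proof.
  unfold dist1; intros H.
  pose proof (Rabs_pos (cx p - cx q)); pose proof (Rabs_pos (cy p - cy q));
  pose proof (Rabs_pos (cz p - cz q)).
  assert (E : forall a b : R, Rabs (a - b) <= 0 -> a = b).
  { intros a b Hab; pose proof (Rle_abs (a - b)); pose proof (Rle_abs (- (a - b)));
    rewrite Rabs_Ropp in *; lra. }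
  apply R3_eq; apply E; lra.
Qed.

Lemma continuous_cx (p : R3) : continuous cx p.
Proof.
  apply (continuous_comp (fun q : R3 => fst q) (fun q : R * R => fst q));
  [destruct p as [p z] | destruct p as [[x y] z]]; apply continuous_fst.
Qed.

Lemma continuous_cy (p : R3) : continuous cy p.
Proof.
  apply (continuous_comp (fun q : R3 => fst q) (fun q : R * R => snd q)).
  - destruct p as [p z]; apply continuous_fst.
  - destruct p as [[x y] z]; apply continuous_snd.
Qed.

Lemma continuous_cz (p : R3) : continuous cz p.
Proof. destruct p as [p z]; apply continuous_snd. Qed.

Lemma continuous_prod {U V W : UniformSpace} (f : U -> V) (g : U -> W) (u : U) :
  continuous f u -> continuous g u -> continuous (fun t => (f t, g t)) u.
Proof.
  intros Hf Hg; apply filterlim_locally; intros eps.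
  apply filter_and; [exact (proj1 (filterlim_locally f (f u)) Hf eps)
                    |exact (proj1 (filterlim_locally g (g u)) Hg eps)].
Qed.

Lemma continuous_mk3 {U : UniformSpace} (f g h : U -> R) (u : U) :
  continuous f u -> continuous g u -> continuous h u ->
  continuous (fun t => mk3 (f t) (g t) (h t)) u.
Proof. intros; repeat apply continuous_prod; assumption. Qed.

Lemma continuous_lipschitz_R (f : R3 -> R) (K : R) (p : R3) :
  (forall q, Rabs (f q - f p) <= K * dist1 q p) -> continuous f p.
Proof.
  intros Hf; apply filterlim_locally; intros eps.
  (* Balls of R3 are cubes, so the l1 distance is below three times the radius; [Rabs K + 1] covers
     [K <= 0]. *)
  assert (Hd : 0 < eps / (3 * (Rabs K + 1))).
  { pose proof (Rabs_pos K); pose proof (cond_pos eps); apply Rdiv_lt_0_compat; lra. }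
  exists (mkposreal _ Hd); intros q [[Hx Hy] Hz].
  change (Rabs (f q - f p) < eps).
  change (Rabs (cx q - cx p) < eps / (3 * (Rabs K + 1))) in Hx.
  change (Rabs (cy q - cy p) < eps / (3 * (Rabs K + 1))) in Hy.
  change (Rabs (cz q - cz p) < eps / (3 * (Rabs K + 1))) in Hz.
  assert (HD : dist1 q p < 3 * (eps / (3 * (Rabs K + 1)))) by (unfold dist1; lra).
  replace (3 * (eps / (3 * (Rabs K + 1)))) with (eps / (Rabs K + 1)) in HD
    by (field; pose proof (Rabs_pos K); lra).
  apply Rle_lt_trans with (1 := Hf q).
  pose proof (dist1_ge0 q p); pose proof (Rle_abs K); pose proof (Rabs_pos K).
  apply Rle_lt_trans with ((Rabs K + 1) * dist1 q p); [nra |].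
  apply Rlt_le_trans with ((Rabs K + 1) * (eps / (Rabs K + 1))).
  - apply Rmult_lt_compat_l; lra.
  - right; field; lra.
Qed.

Lemma continuous_lipschitz (f : R3 -> R3) (K : R) (p : R3) :
  (forall q, dist1 (f q) (f p) <= K * dist1 q p) -> continuous f p.
Proof.
  intros Hf.
  apply continuous_ext with (fun q => mk3 (cx (f q)) (cy (f q)) (cz (f q))).
  { intros q; apply R3_eq; reflexivity. }
  apply continuous_mk3; apply continuous_lipschitz_R with K; intros q;
  refine (Rle_trans _ _ _ _ (Hf q)); unfold dist1;
  pose proof (Rabs_pos (cx (f q) - cx (f p))); pose proof (Rabs_pos (cy (f q) - cy (f p)));
  pose proof (Rabs_pos (cz (f q) - cz (f p))); lra.
Qed.

Lemma homeomorphism_comp (f g : R3 -> R3) :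
  homeomorphism f -> homeomorphism g -> homeomorphism (fun p => g (f p)).
Proof.
  intros [Cf [f' [Cf' [Hf1 Hf2]]]] [Cg [g' [Cg' [Hg1 Hg2]]]]; split.
  - intros p; apply (continuous_comp f g); auto.
  - exists (fun p => f' (g' p)); repeat split.
    + intros p; apply (continuous_comp g' f'); auto.
    + intros p; rewrite Hg1; apply Hf1.
    + intros p; rewrite Hf2; apply Hg2.
Qed.

Lemma homeomorphism_id : homeomorphism (fun p => p).
Proof.
  split; [intros p; apply continuous_id |].
  exists (fun p => p); repeat split; auto; intros p; apply continuous_id.
Qed.

Definition clamp01 (t : R) : R := Rmax 0 (Rmin 1 t).

Lemma clamp01_bounds (t : R) : 0 <= clamp01 t <= 1.
Proof. unfold clamp01, Rmax, Rmin; repeat destruct Rle_dec; lra. Qed.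

Lemma clamp01_continuous (t : R) : continuous clamp01 t.
Proof.
  apply filterlim_locally; intros eps; exists eps; intros u Hu.
  change (Rabs (u - t) < eps) in Hu; change (Rabs (clamp01 u - clamp01 t) < eps).
  apply Rle_lt_trans with (2 := Hu); unfold clamp01, Rmax, Rmin, Rabs.
  repeat destruct Rle_dec; repeat destruct Rcase_abs; lra.
Qed.

Lemma same_knot_type_refl (K : R3 -> Prop) : same_knot_type K K.
Proof.
  exists (fun _ p => p); split; [split; [|split] |].
  - intros t p; apply (continuous_snd t p).
  - intros; apply homeomorphism_id.
  - reflexivity.
  - intros q; split; [intros Hq; exists q; auto | intros [p [Hp <-]]; exact Hp].
Qed.

(** One isotopy runs on the first half of [0, 1], the other on the second. Clamping both times turns
    the concatenation into a composition without case distinction: the second isotopy rests at time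
    0, where it is the identity, while the first one runs, and the first then rests at time 1. *)
Lemma same_knot_type_trans (K1 K2 K3 : R3 -> Prop) :
  same_knot_type K1 K2 -> same_knot_type K2 K3 -> same_knot_type K1 K3.
Proof.
  intros [H [[CH [HH H0]] E]] [H' [[CH' [HH' H0']] E']].
  exists (fun t p => H' (clamp01 (2 * t - 1)) (H (clamp01 (2 * t)) p)).
  assert (E0 : clamp01 (2 * 0) = 0 /\ clamp01 (2 * 0 - 1) = 0 /\
               clamp01 (2 * 1) = 1 /\ clamp01 (2 * 1 - 1) = 1).
  { unfold clamp01, Rmax, Rmin; repeat split; repeat destruct Rle_dec; lra. }
  destruct E0 as [E1 [E2 [E3 E4]]].
  split; [split; [|split] |].
  - intros t p.
    assert (Ct : forall a b : R,
      continuous (fun q : R * R3 => clamp01 (a * fst q + b)) (t, p)).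
    { intros a b.
      apply (continuous_comp (fun q : R * R3 => fst q) (fun x => clamp01 (a * x + b)));
        [apply continuous_fst |].
      apply (continuous_comp (fun x => a * x + b) clamp01); [|apply clamp01_continuous].
      apply (continuous_plus (fun x => a * x) (fun _ => b)); [|apply continuous_const].
      apply (continuous_mult (fun _ => a) (fun x => x));
        [apply continuous_const | apply continuous_id]. }
    apply (continuous_comp_2 (fun q : R * R3 => clamp01 (2 * fst q - 1))
             (fun q : R * R3 => H (clamp01 (2 * fst q)) (snd q)) H' (t, p)).
    + apply (Ct 2 (- 1)).
    + apply (continuous_comp_2 (fun q : R * R3 => clamp01 (2 * fst q)) (fun q => snd q) H).
      * apply continuous_ext with (2 := Ct 2 0); intros q; now rewrite Rplus_0_r.
      * apply continuous_snd.
      * apply CH.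
    + apply CH'.
  - intros t _; apply homeomorphism_comp; [apply HH | apply HH']; apply clamp01_bounds.
  - intros p; rewrite E1, E2, H0; apply H0'.
  - intros q; rewrite E3, E4, E'; split.
    + intros [p [Hp Hq]]; apply E in Hp; destruct Hp as [p' [Hp' Hpp]].
      exists p'; split; [assumption | now rewrite Hpp].
    + intros [p [Hp Hq]]; exists (H 1 p); split; [apply E; eauto | assumption].
Qed.

Lemma same_knot_type_ext (K1 K2 K1' K2' : R3 -> Prop) :
  (forall p, K1 p <-> K1' p) -> (forall p, K2 p <-> K2' p) ->
  same_knot_type K1 K2 -> same_knot_type K1' K2'.
Proof.
  intros H1 H2 [H [HI E]]; exists H; split; [assumption |].
  intros q; rewrite <- H2, E; split; intros [p [Hp Hq]]; exists p; split; auto; now apply H1.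
Qed.

(** * Lipschitz perturbations of the identity *)

(** The l1 distance is used because the constants of the three coordinates simply add up. *)
Definition lipschitz (K : R) (V : R3 -> R3) : Prop :=
  forall p q, dist1 (V p) (V q) <= K * dist1 p q.

Lemma dist1_scal (k : R) (p q : R3) : dist1 (scal3 k p) (scal3 k q) = Rabs k * dist1 p q.
Proof.
  unfold dist1, scal3; cbn.
  rewrite <- !Rmult_minus_distr_l, !Rabs_mult; ring.
Qed.

Lemma dist1_add_l (p q r : R3) : dist1 (add3 p q) (add3 p r) = dist1 q r.
Proof. unfold dist1, add3; cbn; f_equal; [f_equal|]; f_equal; ring. Qed.

Lemma ex_lim_geometric (x : nat -> R) (C : R) :
  (forall k, Rabs (x (S k) - x k) <= C * (/ 2) ^ k) -> ex_finite_lim_seq x.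
Proof.
  intros Hx.
  assert (Es : ex_series (fun k => x (S k) - x k)).
  { apply (ex_series_le (fun k => x (S k) - x k) (fun k => C * (/ 2) ^ k)); [exact Hx |].
    apply (ex_series_scal_l C (fun k => (/ 2) ^ k)); exists (/ (1 - / 2)).
    apply is_series_geom; rewrite Rabs_pos_eq; lra. }
  destruct Es as [l Hl].
  assert (L : is_lim_seq (fun n => sum_n (fun k => x (S k) - x k) n + x 0%nat) (l + x 0%nat)).
  { apply is_lim_seq_plus'; [exact Hl | apply is_lim_seq_const]. }
  exists (l + x 0%nat); apply is_lim_seq_incr_1.
  apply is_lim_seq_ext with (2 := L); intros n; induction n as [|n IH].
  - rewrite sum_O; ring.
  - rewrite sum_Sn, <- IH; unfold plus; cbn; ring.
Qed.

(** Banach iteration from the origin; each coordinate converges because its steps are dominated by a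
    geometric sequence. *)
Lemma contraction_fixed_point (F : R3 -> R3) :
  lipschitz (/ 2) F -> exists p, F p = p.
Proof.
  intros HF.
  set (u := fun k => Nat.iter k F (mk3 0 0 0)).
  set (C := dist1 (u 1%nat) (u 0%nat)).
  assert (Hu : forall k, dist1 (u (S k)) (u k) <= C * (/ 2) ^ k).
  { induction k as [|k IH]; [unfold C; cbn [pow]; lra |].
    change (dist1 (F (u (S k))) (F (u k)) <= C * (/ 2) ^ S k).
    apply Rle_trans with (1 := HF _ _); cbn [pow]; lra. }
  assert (HC : forall f, (f = cx \/ f = cy \/ f = cz) -> ex_finite_lim_seq (fun k => f (u k))).
  { intros f Hf; apply ex_lim_geometric with C; intros k.
    apply Rle_trans with (2 := Hu k); unfold dist1.
    pose proof (Rabs_pos (cx (u (S k)) - cx (u k)));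
    pose proof (Rabs_pos (cy (u (S k)) - cy (u k)));
    pose proof (Rabs_pos (cz (u (S k)) - cz (u k))).
    destruct Hf as [-> | [-> | ->]]; lra. }
  destruct (HC cx) as [lx Lx]; auto; destruct (HC cy) as [ly Ly]; auto;
  destruct (HC cz) as [lz Lz]; auto; clear HC.
  set (p := mk3 lx ly lz); exists p.
  assert (LD : is_lim_seq (fun k => dist1 (u k) p) 0).
  { assert (H1 : forall (v : nat -> R) (l : R), is_lim_seq v l ->
                 is_lim_seq (fun k => Rabs (v k - l)) 0).
    { intros v l Hv.
      assert (H2 : is_lim_seq (fun k => v k - l) 0).
      { replace (Finite 0) with (Finite (l - l)) by (f_equal; ring).
        apply is_lim_seq_minus'; [assumption | apply is_lim_seq_const]. }
      apply is_lim_seq_abs in H2; cbn in H2; now rewrite Rabs_R0 in H2. }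
    unfold dist1; replace (Finite 0) with (Finite (0 + 0 + 0)) by (f_equal; ring).
    repeat apply is_lim_seq_plus'; apply H1; assumption. }
  apply dist1_eq0.
  assert (Hle : forall k, dist1 (F p) p <= / 2 * dist1 (u k) p + dist1 (u (S k)) p).
  { intros k; apply Rle_trans with (1 := dist1_triangle (F p) (u (S k)) p).
    apply Rplus_le_compat_r; rewrite (dist1_sym (u k)); apply HF. }
  apply (is_lim_seq_le (fun _ => dist1 (F p) p) _ (dist1 (F p) p) 0 Hle).
  - apply is_lim_seq_const.
  - replace (Finite 0) with (Finite (/ 2 * 0 + 0)) by (f_equal; ring).
    apply is_lim_seq_plus'.
    + apply (is_lim_seq_scal_l _ (/ 2) 0), LD.
    + apply (is_lim_seq_incr_1 (fun k => dist1 (u k) p)); exact LD.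
Qed.

(** Such a map shrinks distances by a factor 2 at most, so it is injective with Lipschitz inverse. A
    preimage of [q] is a fixed point of the contraction sending [p] to [q - V p]. *)
Lemma homeomorphism_id_plus_lipschitz (V : R3 -> R3) :
  lipschitz (/ 2) V -> homeomorphism (fun p => add3 p (V p)).
Proof.
  intros HV.
  assert (Hlow : forall p q, dist1 p q <= 2 * dist1 (add3 p (V p)) (add3 q (V q))).
  { intros p q; pose proof (HV p q).
    assert (dist1 p q <= dist1 (add3 p (V p)) (add3 q (V q)) + dist1 (V p) (V q)); [|lra].
    unfold dist1, add3; cbn.
    assert (T : forall a b c d : R, Rabs (a - b) <= Rabs (a + c - (b + d)) + Rabs (c - d)).
    { intros a b c d; replace (a - b) with ((a + c - (b + d)) + - (c - d)) by ring.
      rewrite <- (Rabs_Ropp (c - d)); apply Rabs_triang. }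
    pose proof (T (cx p) (cx q) (cx (V p)) (cx (V q)));
    pose proof (T (cy p) (cy q) (cy (V p)) (cy (V q)));
    pose proof (T (cz p) (cz q) (cz (V p)) (cz (V q))); lra. }
  assert (Hsurj : forall q, exists p, add3 p (V p) = q).
  { intros q; destruct (contraction_fixed_point (fun p => add3 q (scal3 (- 1) (V p)))) as [p Hp].
    - intros p r; rewrite dist1_add_l, dist1_scal, Rabs_left by lra; pose proof (HV p r); lra.
    - exists p; rewrite <- Hp at 1; apply R3_eq; cbn; ring. }
  destruct (choice _ Hsurj) as [g Hg]; split.
  - intros p; apply continuous_lipschitz with (3 / 2); intros q.
    apply Rle_trans with (1 := dist1_triangle _ (add3 p (V q)) _).
    rewrite dist1_add_l; pose proof (HV q p).
    replace (dist1 (add3 q (V q)) (add3 p (V q))) with (dist1 q p); [lra |].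
    unfold dist1, add3; cbn; f_equal; [f_equal|]; f_equal; ring.
  - exists g; repeat split.
    + intros p; apply continuous_lipschitz with 2; intros q.
      apply Rle_trans with (1 := Hlow _ _); rewrite !Hg; lra.
    + intros p; apply dist1_eq0.
      apply Rle_trans with (1 := Hlow _ _); rewrite Hg.
      unfold dist1; rewrite !Rminus_diag_eq, Rabs_R0; [lra | reflexivity ..].
    + exact Hg.
Qed.

(* McShane's extension theorem: [V p] is the infimum over [i] of
   [D i + K * dist1 p (c i)]. *)
Lemma lipschitz_extension {I : Type} (i0 : I) (c : I -> R3) (D : I -> R) (K : R) :
  0 <= K ->
  (forall i j, Rabs (D i - D j) <= K * dist1 (c i) (c j)) ->
  exists V : R3 -> R,
    (forall i, V (c i) = D i) /\ (forall p q, Rabs (V p - V q) <= K * dist1 p q).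
Proof.
  intros HK HD.
  (* Opposites are taken because [completeness] provides suprema; the infimum is [- m p]. *)
  set (E := fun p (x : R) => exists i, x = - (D i + K * dist1 p (c i))).
  assert (HE : forall p, exists m, is_lub (E p) m).
  { intros p; destruct (completeness (E p)) as [m Hm].
    - exists (- (D i0 - K * dist1 p (c i0))); intros x [i ->].
      pose proof (HD i0 i) as H1; pose proof (Rle_abs (D i0 - D i)).
      pose proof (dist1_triangle (c i0) p (c i)) as H2; rewrite (dist1_sym (c i0) p) in H2.
      apply Rmult_le_compat_l with (r := K) in H2; [|assumption]; lra.
    - exists (- (D i0 + K * dist1 p (c i0))), i0; reflexivity.
    - exists m; exact Hm. }
  destruct (choice _ HE) as [m Hm]; exists (fun p => - m p); split.
  - intros i; destruct (Hm (c i)) as [Hub Hlub]; apply Rle_antisym.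
    + assert (H : - D i <= m (c i)); [|lra].
      apply Hub; exists i; unfold dist1; rewrite !Rminus_diag_eq, Rabs_R0 by reflexivity; ring.
    + assert (H : m (c i) <= - D i); [|lra].
      apply Hlub; intros x [j ->]; pose proof (HD i j); pose proof (Rle_abs (D i - D j)); lra.
  - assert (H1 : forall p q, m p - m q <= K * dist1 p q).
    { intros p q; assert (H : m p <= m q + K * dist1 p q); [|lra].
      apply (proj2 (Hm p)); intros x [i ->].
      assert (H : - (D i + K * dist1 q (c i)) <= m q) by (apply (proj1 (Hm q)); exists i; auto).
      pose proof (dist1_triangle q p (c i)) as H2; rewrite (dist1_sym q p) in H2.
      apply Rmult_le_compat_l with (r := K) in H2; [|assumption]; lra. }
    intros p q; apply Rabs_le; pose proof (H1 p q); pose proof (H1 q p) as H2.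
    rewrite (dist1_sym q p) in H2; lra.
Qed.

(* If [c' - c] is Lipschitz with respect to the chords of [c], extend it to a
   vector field [V] on the whole space with Lipschitz constant 1/2; then
   [p + t V p] is an ambient isotopy. *)
Lemma same_knot_type_lipschitz (c c' : R -> R3) :
  (forall s t,
     Rabs ((cx (c' s) - cx (c s)) - (cx (c' t) - cx (c t))) <= / 6 * dist1 (c s) (c t) /\
     Rabs ((cy (c' s) - cy (c s)) - (cy (c' t) - cy (c t))) <= / 6 * dist1 (c s) (c t) /\
     Rabs ((cz (c' s) - cz (c s)) - (cz (c' t) - cz (c t))) <= / 6 * dist1 (c s) (c t)) ->
  same_knot_type (image c) (image c').
Proof.
  intros HD.
  destruct (lipschitz_extension 0 c (fun s => cx (c' s) - cx (c s)) (/ 6)) as [Vx [Ex Lx]];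
    [lra | apply HD |].
  destruct (lipschitz_extension 0 c (fun s => cy (c' s) - cy (c s)) (/ 6)) as [Vy [Ey Ly]];
    [lra | apply HD |].
  destruct (lipschitz_extension 0 c (fun s => cz (c' s) - cz (c s)) (/ 6)) as [Vz [Ez Lz]];
    [lra | apply HD |].
  set (V := fun p => mk3 (Vx p) (Vy p) (Vz p)).
  (* Three coordinates with constant 1/6 give 1/2, the constant of
     [homeomorphism_id_plus_lipschitz]. *)
  assert (LV : lipschitz (/ 2) V).
  { intros p q; pose proof (Lx p q); pose proof (Ly p q); pose proof (Lz p q).
    change (Rabs (Vx p - Vx q) + Rabs (Vy p - Vy q) + Rabs (Vz p - Vz q) <= / 2 * dist1 p q).
    lra. }
  exists (fun t p => add3 p (scal3 t (V p))); split; [split; [|split] |].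
  - intros t p.
    assert (Hc : forall (f g : R3 -> R), (forall p, continuous f p) -> (forall p, continuous g p) ->
      continuous (fun q : R * R3 => f (snd q) + fst q * g (snd q)) (t, p)).
    { intros f g Hf Hg.
      apply (continuous_plus (fun q : R * R3 => f (snd q)) (fun q : R * R3 => fst q * g (snd q))).
      - apply (continuous_comp (fun q : R * R3 => snd q) f); [apply continuous_snd | apply Hf].
      - apply (continuous_mult (fun q : R * R3 => fst q) (fun q : R * R3 => g (snd q)));
          [apply continuous_fst |].
        apply (continuous_comp (fun q : R * R3 => snd q) g); [apply continuous_snd | apply Hg]. }
    apply (continuous_mk3 (fun q : R * R3 => cx (snd q) + fst q * Vx (snd q))
      (fun q : R * R3 => cy (snd q) + fst q * Vy (snd q))
      (fun q : R * R3 => cz (snd q) + fst q * Vz (snd q))); apply Hc;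
      intros r; try apply continuous_cx; try apply continuous_cy; try apply continuous_cz;
      apply continuous_lipschitz_R with (/ 6); intros q; auto.
  - intros t Ht; apply (homeomorphism_id_plus_lipschitz (fun p => scal3 t (V p))).
    intros p q; rewrite dist1_scal, Rabs_pos_eq by lra.
    pose proof (LV p q); pose proof (dist1_ge0 (V p) (V q)); nra.
  - intros p; apply R3_eq; cbn; ring.
  - assert (E : forall s, add3 (c s) (scal3 1 (V (c s))) = c' s).
    { intros s; apply R3_eq; cbn; [rewrite Ex | rewrite Ey | rewrite Ez]; ring. }
    intros q; split.
    + intros [s <-]; exists (c s); split; [exists s; reflexivity | apply E].
    + intros [p [[s <-] Hq]]; exists s; rewrite <- Hq; symmetry; apply E.
Qed.

(** * Families of embedded closed curves *)

Lemma periodic_Z {A : Type} (f : R -> A) (L : R) :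
  (forall s, f (s + L) = f s) -> forall (k : Z) s, f (s + IZR k * L) = f s.
Proof.
  intros Hf.
  assert (HN : forall (n : nat) s, f (s + INR n * L) = f s).
  { induction n as [|n IH]; intros s; [f_equal; cbn; ring |].
    rewrite S_INR, <- (IH s), <- (Hf (s + INR n * L)); f_equal; ring. }
  intros k s; destruct (Z_le_gt_dec 0 k) as [Hk|Hk].
  - rewrite <- (Z2Nat.id k Hk), <- INR_IZR_INZ; apply HN.
  - rewrite <- (HN (Z.to_nat (- k)) (s + IZR k * L)), INR_IZR_INZ, Z2Nat.id, opp_IZR by lia.
    f_equal; ring.
Qed.

Lemma exists_period (L : R) (hL : 0 < L) (s : R) :
  exists k : Z, 0 <= s - IZR k * L < L.
Proof.
  destruct (floor_ex (s / L)) as [k [H1 H2]]; exists k.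
  replace s with (s / L * L) by (field; lra); nra.
Qed.

Lemma is_derive_periodic (f f1 : R -> R) (L : R) :
  (forall s, is_derive f s (f1 s)) -> (forall s, f (s + L) = f s) ->
  forall s, f1 (s + L) = f1 s.
Proof.
  intros Hd Hp s.
  assert (H : is_derive f s (f1 (s + L))).
  { apply is_derive_ext with (fun t => f (t + L)); [exact Hp |].
    rewrite <- (Rmult_1_l (f1 (s + L))).
    apply (is_derive_comp f (fun t => t + L)); [apply Hd | auto_derive; auto]. }
  apply is_derive_unique in H; rewrite <- H; apply is_derive_unique, Hd.
Qed.

Lemma mean_value (f f1 : R -> R) (a b : R) :
  (forall s, is_derive f s (f1 s)) ->
  exists c, Rmin a b <= c <= Rmax a b /\ f b - f a = f1 c * (b - a).
Proof.
  intros Hd; apply MVT_gen; [auto |].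
  intros s _; apply continuity_pt_filterlim, (ex_derive_continuous f); exists (f1 s); apply Hd.
Qed.

(** * The chord-arc inequality for embedded closed curves *)

Definition C1_periodic (L : R) (f f1 : R -> R) : Prop :=
  (forall s, is_derive f s (f1 s)) /\ (forall s, continuous f1 s) /\
  (forall s, f (s + L) = f s).

Lemma continuous_Rabs_bound (f : R -> R) (u : R) (eps : R) :
  0 < eps -> continuous f u ->
  exists d : posreal, forall s, Rabs (s - u) < d -> Rabs (f s - f u) < eps.
Proof.
  intros He Hf; destruct (proj1 (filterlim_locally f (f u)) Hf (mkposreal _ He)) as [d Hd].
  exists d; intros s Hs; apply Hd; exact Hs.
Qed.

(** Near [u] the derivative keeps half of its absolute value, and the mean value theorem turns this
    into expansion. One number [d] is both radius and factor, so that compactness can later be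
    applied to a single gauge. *)
Lemma expansive_near (L : R) (f f1 : R -> R) (u : R) :
  C1_periodic L f f1 -> f1 u <> 0 ->
  exists d : posreal, forall s t, Rabs (s - u) < d -> Rabs (t - u) < d ->
    d * Rabs (s - t) <= Rabs (f s - f t).
Proof.
  intros [Hd [Hc _]] Hu.
  pose proof (Rabs_pos_lt _ Hu) as Hpos.
  destruct (continuous_Rabs_bound f1 u (Rabs (f1 u) / 2)) as [d H]; [lra | apply Hc |].
  assert (H0 : 0 < Rmin d (Rabs (f1 u) / 2)) by (apply Rmin_pos; [apply cond_pos | lra]).
  exists (mkposreal _ H0); cbn; intros s t Hs Ht.
  pose proof (Rmin_l d (Rabs (f1 u) / 2)); pose proof (Rmin_r d (Rabs (f1 u) / 2)).
  destruct (mean_value f f1 t s Hd) as [c [Hcc ->]].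
  assert (Hcu : Rabs (c - u) < d).
  { apply Rabs_def2 in Hs; apply Rabs_def2 in Ht; apply Rabs_def1;
    revert Hcc; unfold Rmin, Rmax in *; repeat destruct Rle_dec; lra. }
  rewrite Rabs_mult; apply Rmult_le_compat_r; [apply Rabs_pos |].
  pose proof (H c Hcu) as Hc1; rewrite Rabs_minus_sym in Hc1.
  pose proof (Rabs_triang_inv (f1 u) (f1 u - f1 c)) as Hc2.
  replace (f1 u - (f1 u - f1 c)) with (f1 c) in Hc2 by ring; lra.
Qed.

Definition embedded (L : R) (x y z x1 y1 z1 : R -> R) : Prop :=
  (forall s, x1 s = 0 -> y1 s = 0 -> z1 s = 0 -> False) /\
  (forall s t, x s = x t -> y s = y t -> z s = z t -> exists k : Z, s - t = IZR k * L).

Lemma C1_periodic_continuous (L : R) (f f1 : R -> R) (s : R) :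
  C1_periodic L f f1 -> continuous f s.
Proof. intros [H _]; apply (ex_derive_continuous f); exists (f1 s); apply H. Qed.

(** If [u] and [v] give distinct points, chords nearby are bounded below. If [u = v], some
    coordinate is expansive by immersion. If they differ by a nonzero multiple of [L], the
    restriction [Rabs (s - t) <= L / 2] excludes all nearby pairs. *)
Lemma chord_arc_local (L : R) (x y z x1 y1 z1 : R -> R) :
  0 < L -> C1_periodic L x x1 -> C1_periodic L y y1 -> C1_periodic L z z1 ->
  embedded L x y z x1 y1 z1 ->
  forall u v, exists d : posreal, forall s t,
    Rabs (s - u) < d -> Rabs (t - v) < d -> Rabs (s - t) <= L / 2 ->
    d * Rabs (s - t) <= Rabs (x s - x t) + Rabs (y s - y t) + Rabs (z s - z t).
Proof.
  intros hL Hx Hy Hz [Himm Hinj] u v.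
  destruct (Req_dec (Rabs (x u - x v) + Rabs (y u - y v) + Rabs (z u - z v)) 0) as [H0|H0].
  - pose proof (Rabs_pos (x u - x v)); pose proof (Rabs_pos (y u - y v));
    pose proof (Rabs_pos (z u - z v)).
    assert (E : forall a b, Rabs (a - b) = 0 -> a = b).
    { intros a b Hab; destruct (Req_dec (a - b) 0) as [|Hn]; [lra |].
      apply Rabs_pos_lt in Hn; lra. }
    destruct (Hinj u v) as [k Hk]; [apply E; lra .. |].
    destruct (Z.eq_dec k 0) as [->|Hk0].
    + assert (v = u) by lra; subst v; clear Hk.
      assert (Hcase : x1 u <> 0 \/ y1 u <> 0 \/ z1 u <> 0).
      { destruct (Req_dec (x1 u) 0); [|auto]; destruct (Req_dec (y1 u) 0); [|auto];
        destruct (Req_dec (z1 u) 0); [|auto]; exfalso; eapply Himm; eauto. }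
      destruct Hcase as [Hu|[Hu|Hu]];
      [destruct (expansive_near L x x1 u Hx Hu) as [d Hd]
      |destruct (expansive_near L y y1 u Hy Hu) as [d Hd]
      |destruct (expansive_near L z z1 u Hz Hu) as [d Hd]];
      exists d; intros s t Hs Ht _; pose proof (Hd s t Hs Ht);
      pose proof (Rabs_pos (x s - x t)); pose proof (Rabs_pos (y s - y t));
      pose proof (Rabs_pos (z s - z t)); lra.
    (* Here [|u - v| >= L], so within radius [L / 8] one has [|s - t| > 3 L / 4], against [Hst]. *)
    + assert (Hd : 0 < L / 8) by lra; exists (mkposreal _ Hd); cbn; intros s t Hs Ht Hst.
      exfalso; apply Rabs_def2 in Hs; apply Rabs_def2 in Ht; apply Rabs_le_between in Hst.
      assert (Hk1 : (k <= -1 \/ 1 <= k)%Z) by lia.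
      destruct Hk1 as [Hk1|Hk1]; apply IZR_le in Hk1; nra.
  - set (g := Rabs (x u - x v) + Rabs (y u - y v) + Rabs (z u - z v)) in *.
    assert (Hg : 0 < g).
    { assert (0 <= g); [|lra]; unfold g; repeat apply Rplus_le_le_0_compat; apply Rabs_pos. }
    assert (Hloc : forall f f1, C1_periodic L f f1 -> exists d : posreal, forall s t,
      Rabs (s - u) < d -> Rabs (t - v) < d -> Rabs (f u - f v) <= Rabs (f s - f t) + g / 6).
    { intros f f1 Hf.
      destruct (continuous_Rabs_bound f u (g / 12)) as [d1 H1];
        [lra | eapply C1_periodic_continuous; eauto |].
      destruct (continuous_Rabs_bound f v (g / 12)) as [d2 H2];
        [lra | eapply C1_periodic_continuous; eauto |].
      assert (Hd : 0 < Rmin d1 d2) by (apply Rmin_pos; apply cond_pos).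
      exists (mkposreal _ Hd); cbn; intros s t Hs Ht.
      assert (H3 := H1 s (Rlt_le_trans _ _ _ Hs (Rmin_l _ _))).
      assert (H4 := H2 t (Rlt_le_trans _ _ _ Ht (Rmin_r _ _))).
      apply Rabs_def2 in H3; apply Rabs_def2 in H4.
      unfold Rabs; repeat destruct Rcase_abs; lra. }
    destruct (Hloc x x1 Hx) as [dx Dx]; destruct (Hloc y y1 Hy) as [dy Dy];
    destruct (Hloc z z1 Hz) as [dz Dz].
    (* Each coordinate loses at most [g / 6], so half of [g] is left; [g / L] makes
       [d * Rabs (s - t)] at most [g / 2]. *)
    assert (Hd : 0 < Rmin (Rmin dx dy) (Rmin dz (g / L))).
    { repeat apply Rmin_pos; try apply cond_pos; apply Rdiv_lt_0_compat; lra. }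
    exists (mkposreal _ Hd); cbn; intros s t Hs Ht Hst.
    set (d := Rmin (Rmin dx dy) (Rmin dz (g / L))) in *.
    assert (d <= dx) by (unfold d; eapply Rle_trans; [apply Rmin_l | apply Rmin_l]).
    assert (d <= dy) by (unfold d; eapply Rle_trans; [apply Rmin_l | apply Rmin_r]).
    assert (d <= dz) by (unfold d; eapply Rle_trans; [apply Rmin_r | apply Rmin_l]).
    assert (Hd4 : d <= g / L) by (unfold d; eapply Rle_trans; [apply Rmin_r | apply Rmin_r]).
    pose proof (Dx s t ltac:(lra) ltac:(lra)); pose proof (Dy s t ltac:(lra) ltac:(lra));
    pose proof (Dz s t ltac:(lra) ltac:(lra)).
    assert (d * Rabs (s - t) <= g / 2); [|unfold g in *; lra].
    apply Rle_trans with (g / L * (L / 2)); [|right; field; lra].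
    apply Rmult_le_compat; [lra | apply Rabs_pos | assumption ..].
Qed.

(** Shifting [s] into [[0, L]] by a period keeps [t] in [[- L, 2 L]], and on this compact box the
    local gauges have a common positive lower bound. A bound on the parameter distance is essential,
    since the chord vanishes at distance [L]. *)
Lemma chord_arc (L : R) (x y z x1 y1 z1 : R -> R) :
  0 < L -> C1_periodic L x x1 -> C1_periodic L y y1 -> C1_periodic L z z1 ->
  embedded L x y z x1 y1 z1 ->
  exists d : posreal, forall s t, Rabs (s - t) <= L / 2 ->
    d * Rabs (s - t) <= Rabs (x s - x t) + Rabs (y s - y t) + Rabs (z s - z t).
Proof.
  intros hL Hx Hy Hz He.
  pose proof (chord_arc_local L x y z x1 y1 z1 hL Hx Hy Hz He) as Hloc.
  set (delta := fun u v => proj1_sig (constructive_indefinite_description _ (Hloc u v))).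
  destruct (compactness_value_2d 0 L (- L) (2 * L) delta) as [d Hd].
  exists d; intros s t Hst.
  destruct (exists_period L hL s) as [k Hk].
  assert (Hp : forall f f1 r, C1_periodic L f f1 -> f (r - IZR k * L) = f r).
  { intros f f1 r [_ [_ Hf]]; rewrite <- (periodic_Z f L Hf k (r - IZR k * L)); f_equal; ring. }
  rewrite <- (Hp x x1 s Hx), <- (Hp x x1 t Hx), <- (Hp y y1 s Hy), <- (Hp y y1 t Hy),
    <- (Hp z z1 s Hz), <- (Hp z z1 t Hz).
  replace (s - t) with ((s - IZR k * L) - (t - IZR k * L)) in Hst |- * by ring.
  set (s' := s - IZR k * L) in *; set (t' := t - IZR k * L) in *; clearbody s' t'.
  clear s t k Hp.
  assert (Ht' : - L <= t' <= 2 * L) by (apply Rabs_le_between in Hst; lra).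
  (* The compactness statement [Hd] is doubly negated, hence the argument by contradiction. *)
  match goal with |- ?G => destruct (classic G) as [HG|HG]; [exact HG | exfalso] end.
  apply (Hd s' t'); [lra | lra |]; intros [u [v [_ [_ [H1 [H2 H3]]]]]]; apply HG.
  unfold delta in *; destruct constructive_indefinite_description as [e He']; cbn in *.
  pose proof (He' s' t' H1 H2 Hst).
  apply Rle_trans with (2 := H); apply Rmult_le_compat_r; [apply Rabs_pos | assumption].
Qed.

(** * Constancy of the knot type along C^1 families *)

Definition C1_family (L : R) (f f1 : R -> R -> R) : Prop :=
  (forall t s, is_derive (f t) s (f1 t s)) /\ (forall t s, continuity_2d_pt f1 t s) /\
  (forall t s, f t (s + L) = f t s).

Lemma C1_family_periodic (L : R) (f f1 : R -> R -> R) (t : R) :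
  C1_family L f f1 -> C1_periodic L (f t) (f1 t).
Proof.
  intros [Hd [Hc Hp]]; split; [|split]; auto.
  intros s; apply filterlim_locally; intros eps; destruct (Hc t s eps) as [d H].
  exists d; intros r Hr; apply H; [rewrite Rminus_diag_eq, Rabs_R0; [apply cond_pos | easy] |].
  exact Hr.
Qed.

(** By the mean value theorem for [f t - f t0] it is enough that its derivative be small. This holds
    uniformly on one period by uniform continuity of [f1], and then everywhere because [f1 t] is
    periodic too. *)
Lemma C1_family_lipschitz (L : R) (f f1 : R -> R -> R) (t0 eps : R) :
  0 < L -> 0 < eps -> C1_family L f f1 ->
  exists eta : posreal, forall t, Rabs (t - t0) < eta -> forall s r,
    Rabs ((f t s - f t0 s) - (f t r - f t0 r)) <= eps * Rabs (s - r).
Proof.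
  intros hL He [Hd [Hc Hp]].
  destruct (uniform_continuity_2d_1d' f1 0 L t0 (fun s _ => Hc t0 s) (mkposreal _ He)) as [eta H].
  cbn in H; exists eta; intros t Ht s r.
  destruct (mean_value (fun s => f t s - f t0 s) (fun s => f1 t s - f1 t0 s) r s) as [c [_ ->]].
  { intros q; apply (is_derive_minus (f t) (f t0)); apply Hd. }
  rewrite Rabs_mult; apply Rmult_le_compat_r; [apply Rabs_pos |].
  destruct (exists_period L hL c) as [k Hk].
  assert (Hq : forall q, f1 q c = f1 q (c - IZR k * L)).
  { intros q; rewrite <- (periodic_Z (f1 q) L (is_derive_periodic (f q) (f1 q) L (Hd q) (Hp q)) k
                          (c - IZR k * L)); f_equal; ring. }
  rewrite !Hq; left; pose proof (cond_pos eta); apply Rabs_def2 in Ht.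
  apply H; rewrite ?Rminus_diag_eq, ?Rabs_R0 by easy; lra.
Qed.

(** Let [m] be the supremum of the times where [P] holds. The hypothesis at [m] compares any two
    nearby times, so a time just below [m] hands [P] on to one beyond [m], unless [m = 1]. *)
Lemma unit_interval_connected (P : R -> Prop) :
  P 0 ->
  (forall t0, 0 <= t0 <= 1 -> exists eta : posreal, forall t t',
     0 <= t <= 1 -> 0 <= t' <= 1 -> Rabs (t - t0) < eta -> Rabs (t' - t0) < eta -> P t -> P t') ->
  P 1.
Proof.
  intros H0 Hloc.
  set (E := fun t => 0 <= t <= 1 /\ P t).
  destruct (completeness E) as [m [Hub Hlub]].
  { exists 1; intros t [Ht _]; lra. }
  { exists 0; split; [lra | assumption]. }
  assert (Hm : 0 <= m <= 1).
  { split; [apply Hub; split; [lra | assumption] | apply Hlub; intros t [Ht _]; lra]. }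
  destruct (Hloc m Hm) as [eta Heta]; pose proof (cond_pos eta) as He.
  assert (Hex : exists t, E t /\ m - eta < t).
  { match goal with |- ?G => destruct (classic G) as [HG|HG]; [exact HG | exfalso] end.
    assert (m <= m - eta); [|lra].
    apply Hlub; intros t Ht; destruct (Rle_dec t (m - eta)); [assumption |].
    exfalso; apply HG; exists t; split; [assumption | lra]. }
  destruct Hex as [t [Ht Htm]]; pose proof (Hub t Ht); destruct Ht as [Ht Pt].
  set (t' := Rmin 1 (m + eta / 2)).
  assert (Ht' : 0 <= t' <= 1 /\ Rabs (t' - m) < eta).
  { unfold t', Rmin; destruct Rle_dec; (split; [|apply Rabs_def1]); lra. }
  assert (Pt' : P t') by (apply (Heta t t'); [tauto | tauto | apply Rabs_def1; lra | tauto | auto]).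
  assert (t' <= m) by (apply Hub; split; tauto).
  assert (t' = 1) by (unfold t', Rmin in *; destruct Rle_dec; lra); congruence.
Qed.

(** For [t] near [t0] the displacement between the curves is small compared with the chords of the
    curve at [t0], by its chord-arc constant. [same_knot_type_lipschitz] is applied both from [t0]
    to [t] and from [t] to [t0], so that no isotopy has to be inverted. *)
Theorem same_knot_type_family (L : R) (x y z x1 y1 z1 : R -> R -> R) :
  0 < L -> C1_family L x x1 -> C1_family L y y1 -> C1_family L z z1 ->
  (forall t, 0 <= t <= 1 -> embedded L (x t) (y t) (z t) (x1 t) (y1 t) (z1 t)) ->
  same_knot_type (image (fun s => mk3 (x 0 s) (y 0 s) (z 0 s)))
                 (image (fun s => mk3 (x 1 s) (y 1 s) (z 1 s))).
Proof.
  intros hL Hx Hy Hz He.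
  set (c := fun t s => mk3 (x t s) (y t s) (z t s)).
  change (same_knot_type (image (c 0)) (image (c 1))).
  apply (unit_interval_connected (fun t => same_knot_type (image (c 0)) (image (c t))));
    [apply same_knot_type_refl |].
  intros t0 Ht0.
  destruct (chord_arc L (x t0) (y t0) (z t0) (x1 t0) (y1 t0) (z1 t0)) as [d Hd];
    auto using C1_family_periodic.
  (* With 1/12 the chords of the nearby curve keep 3/4 of their length, the three coordinates
     costing 1/4 together, and [1/12 <= 1/6 * 3/4] allows the way back from [t] to [t0]. *)
  assert (Hd12 : 0 < d / 12) by (pose proof (cond_pos d); lra).
  assert (Hf : forall f f1, C1_family L f f1 -> exists eta : posreal, forall t,
    Rabs (t - t0) < eta -> forall s r,
    Rabs ((f t s - f t0 s) - (f t r - f t0 r)) <= / 12 * dist1 (c t0 s) (c t0 r)).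
  { intros f f1 Hff; destruct (C1_family_lipschitz L f f1 t0 (d / 12)) as [eta H]; auto.
    exists eta; intros t Ht s r.
    (* Moving [r] by [k] periods brings it within [L / 2] of [s], where the chord-arc bound
       applies. *)
    destruct (exists_period L hL (s - r + L / 2)) as [k Hk].
    assert (Hp : forall g g1 q, C1_family L g g1 -> g q r = g q (r + IZR k * L)).
    { intros g g1 q [_ [_ Hg]]; symmetry; apply (periodic_Z (g q) L (Hg q)). }
    unfold dist1, c; cbn.
    rewrite (Hp x x1 t0 Hx), (Hp y y1 t0 Hy), (Hp z z1 t0 Hz),
      (Hp f f1 t0 Hff), (Hp f f1 t Hff).
    apply Rle_trans with (1 := H t Ht _ _).
    assert (Hsr : Rabs (s - (r + IZR k * L)) <= L / 2) by (apply Rabs_le; lra).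
    pose proof (Hd _ _ Hsr); lra. }
  destruct (Hf x x1 Hx) as [ex Ex]; destruct (Hf y y1 Hy) as [ey Ey];
  destruct (Hf z z1 Hz) as [ez Ez].
  assert (Heta : 0 < Rmin ex (Rmin ey ez)) by (repeat apply Rmin_pos; apply cond_pos).
  exists (mkposreal _ Heta); cbn.
  assert (Hmin : forall t, Rabs (t - t0) < Rmin ex (Rmin ey ez) ->
    Rabs (t - t0) < ex /\ Rabs (t - t0) < ey /\ Rabs (t - t0) < ez).
  { intros t; unfold Rmin; repeat destruct Rle_dec; lra. }
  assert (Hto : forall t, Rabs (t - t0) < Rmin ex (Rmin ey ez) ->
    same_knot_type (image (c t0)) (image (c t))).
  { intros t Ht; apply Hmin in Ht; destruct Ht as [Htx [Hty Htz]].
    apply same_knot_type_lipschitz; intros s r; cbn.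
    pose proof (Ex t Htx s r); pose proof (Ey t Hty s r); pose proof (Ez t Htz s r);
    pose proof (dist1_ge0 (c t0 s) (c t0 r)); repeat split; lra. }
  assert (Hfrom : forall t, Rabs (t - t0) < Rmin ex (Rmin ey ez) ->
    same_knot_type (image (c t)) (image (c t0))).
  { intros t Ht; apply Hmin in Ht; destruct Ht as [Htx [Hty Htz]].
    apply same_knot_type_lipschitz; intros s r; cbn.
    pose proof (Ex t Htx s r) as Fx; pose proof (Ey t Hty s r) as Fy;
    pose proof (Ez t Htz s r) as Fz; pose proof (dist1_ge0 (c t0 s) (c t0 r)).
    assert (HD : 3 / 4 * dist1 (c t0 s) (c t0 r) <= dist1 (c t s) (c t r)).
    { assert (T : forall a b a' b', Rabs (a - b) <= Rabs (a' - b') + Rabs ((a' - a) - (b' - b))).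
      { intros a b a' b'; replace (a - b) with ((a' - b') + - ((a' - a) - (b' - b))) by ring.
        rewrite <- (Rabs_Ropp ((a' - a) - (b' - b))); apply Rabs_triang. }
      pose proof (T (x t0 s) (x t0 r) (x t s) (x t r));
      pose proof (T (y t0 s) (y t0 r) (y t s) (y t r));
      pose proof (T (z t0 s) (z t0 r) (z t s) (z t r)).
      unfold dist1, c in *; cbn in *; lra. }
    assert (S : forall a b a' b', Rabs ((a - b) - (a' - b')) = Rabs ((b - a) - (b' - a'))).
    { intros a b a' b'; rewrite <- Rabs_Ropp; f_equal; ring. }
    rewrite (S (x t0 s)), (S (y t0 s)), (S (z t0 s)); repeat split; lra. }
  intros t t' _ _ Ht Ht' HP.
  apply same_knot_type_trans with (1 := HP).
  apply same_knot_type_trans with (image (c t0)); auto.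
Qed.

(** * Curves winding on tori of revolution *)

Definition cyl (rho theta z : R -> R) (s : R) : R3 :=
  mk3 (rho s * cos (theta s)) (rho s * sin (theta s)) (z s).

Definition C1_2d (f f1 : R -> R -> R) : Prop :=
  (forall t s, is_derive (f t) s (f1 t s)) /\
  (forall t s, continuity_2d_pt f t s) /\ (forall t s, continuity_2d_pt f1 t s).

Lemma cos_sin_eq (a b : R) :
  cos a = cos b -> sin a = sin b -> exists k : Z, a - b = IZR k * (2 * PI).
Proof.
  intros Hc Hs.
  assert (H1 : cos (a - b) = 1).
  { rewrite cos_minus, Hc, Hs; pose proof (sin2_cos2 b); unfold Rsqr in *; lra. }
  assert (H2 : sin ((a - b) / 2) = 0).
  { replace (a - b) with (2 * ((a - b) / 2)) in H1 by field.
    rewrite cos_2a_sin in H1; nra. }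
  destruct (sin_eq_0_0 _ H2) as [k Hk]; exists k; lra.
Qed.

Lemma polar_coordinates_unique (r r' a b : R) :
  0 < r -> 0 < r' -> r * cos a = r' * cos b -> r * sin a = r' * sin b ->
  r = r' /\ exists k : Z, a - b = IZR k * (2 * PI).
Proof.
  intros hr hr' Hc Hs.
  pose proof (sin2_cos2 a) as Ea; pose proof (sin2_cos2 b) as Eb; unfold Rsqr in *.
  assert (Hrr : r = r').
  { apply Rsqr_inj; [lra | lra |]; unfold Rsqr.
    transitivity ((r * cos a) * (r * cos a) + (r * sin a) * (r * sin a)).
    - rewrite <- (Rmult_1_r (r * r)), <- Ea; ring.
    - rewrite Hc, Hs, <- (Rmult_1_r (r' * r')), <- Eb; ring. }
  subst r'; split; [reflexivity |].
  apply Rmult_eq_reg_l in Hc; [|lra]; apply Rmult_eq_reg_l in Hs; [|lra].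
  exact (cos_sin_eq a b Hc Hs).
Qed.

Lemma cos_add_2PI (a : R) (k : Z) : cos (a + IZR k * (2 * PI)) = cos a.
Proof.
  apply (periodic_Z cos); intros s; rewrite cos_plus, cos_2PI, sin_2PI; ring.
Qed.

Lemma sin_add_2PI (a : R) (k : Z) : sin (a + IZR k * (2 * PI)) = sin a.
Proof.
  apply (periodic_Z sin); intros s; rewrite sin_plus, cos_2PI, sin_2PI; ring.
Qed.

Lemma continuity_2d_cos (f : R -> R -> R) (t s : R) :
  continuity_2d_pt f t s -> continuity_2d_pt (fun u v => cos (f u v)) t s.
Proof. apply (continuity_1d_2d_pt_comp cos), continuity_cos. Qed.

Lemma continuity_2d_sin (f : R -> R -> R) (t s : R) :
  continuity_2d_pt f t s -> continuity_2d_pt (fun u v => sin (f u v)) t s.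
Proof. apply (continuity_1d_2d_pt_comp sin), continuity_sin. Qed.

Lemma is_derive_mul (f g : R -> R) (s a b : R) :
  is_derive f s a -> is_derive g s b -> is_derive (fun t => f t * g t) s (a * g s + f s * b).
Proof. intros Hf Hg; apply (is_derive_mult f g); [assumption .. | exact Rmult_comm]. Qed.

Lemma is_derive_cos_comp (f : R -> R) (s a : R) :
  is_derive f s a -> is_derive (fun t => cos (f t)) s (- (a * sin (f s))).
Proof.
  intros Hf; replace (- (a * sin (f s))) with (a * - sin (f s)) by ring.
  apply (is_derive_comp cos f); [apply is_derive_cos | exact Hf].
Qed.

Lemma is_derive_sin_comp (f : R -> R) (s a : R) :
  is_derive f s a -> is_derive (fun t => sin (f t)) s (a * cos (f s)).
Proof. intros Hf; apply (is_derive_comp sin f); [apply is_derive_sin | exact Hf]. Qed.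

(** In the radial, angular and vertical directions the velocity is [(rho1, rho * theta1, z1)], so
    away from the axis immersion and injectivity can be read off cylindrical data. The [k] full
    turns gained over a period are invisible in Cartesian coordinates. *)
Lemma same_knot_type_cyl_family (L : R) (k : Z) (rho theta z rho1 theta1 z1 : R -> R -> R) :
  0 < L -> C1_2d rho rho1 -> C1_2d theta theta1 -> C1_2d z z1 ->
  (forall t s, rho t (s + L) = rho t s) -> (forall t s, z t (s + L) = z t s) ->
  (forall t s, theta t (s + L) = theta t s + IZR k * (2 * PI)) ->
  (forall t s, 0 <= t <= 1 -> 0 < rho t s) ->
  (forall t s, 0 <= t <= 1 -> rho1 t s = 0 -> theta1 t s = 0 -> z1 t s = 0 -> False) ->
  (forall t s r (j : Z), 0 <= t <= 1 -> rho t s = rho t r -> z t s = z t r ->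
     theta t s - theta t r = IZR j * (2 * PI) -> exists i : Z, s - r = IZR i * L) ->
  same_knot_type (image (cyl (rho 0) (theta 0) (z 0))) (image (cyl (rho 1) (theta 1) (z 1))).
Proof.
  intros hL [Dr [Cr Cr1]] [Dth [Cth Cth1]] [Dz [Cz Cz1]] Pr Pz Pth Hpos Himm Hinj.
  apply (same_knot_type_family L
    (fun t s => rho t s * cos (theta t s)) (fun t s => rho t s * sin (theta t s)) z
    (fun t s => rho1 t s * cos (theta t s) - rho t s * (theta1 t s * sin (theta t s)))
    (fun t s => rho1 t s * sin (theta t s) + rho t s * (theta1 t s * cos (theta t s))) z1 hL).
  - split; [|split].
    + intros t s; replace (_ - _) with (rho1 t s * cos (theta t s) +
        rho t s * - (theta1 t s * sin (theta t s))) by ring.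
      apply (is_derive_mul (rho t) (fun v => cos (theta t v))); auto using is_derive_cos_comp.
    + intros t s; apply continuity_2d_pt_minus; repeat apply continuity_2d_pt_mult;
        auto using continuity_2d_cos, continuity_2d_sin.
    + intros t s; rewrite Pr, Pth, cos_add_2PI; reflexivity.
  - split; [|split].
    + intros t s; apply (is_derive_mul (rho t) (fun v => sin (theta t v))); auto using is_derive_sin_comp.
    + intros t s; apply continuity_2d_pt_plus; repeat apply continuity_2d_pt_mult;
        auto using continuity_2d_cos, continuity_2d_sin.
    + intros t s; rewrite Pr, Pth, sin_add_2PI; reflexivity.
  - split; [|split]; auto.
  - intros t Ht; split.
    + intros s Hx Hy Hz; apply (Himm t s Ht); [| | exact Hz];
      pose proof (sin2_cos2 (theta t s)) as E; unfold Rsqr in E; pose proof (Hpos t s Ht);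
      set (C := cos (theta t s)) in *; set (S := sin (theta t s)) in *.
      * replace (rho1 t s) with (rho1 t s * (S * S + C * C)) by (rewrite E; ring).
        replace (rho1 t s * (S * S + C * C)) with
          (C * (rho1 t s * C - rho t s * (theta1 t s * S)) +
           S * (rho1 t s * S + rho t s * (theta1 t s * C))) by ring.
        rewrite Hx, Hy; ring.
      * apply Rmult_eq_reg_l with (rho t s); [|lra]; rewrite Rmult_0_r.
        replace (rho t s * theta1 t s) with (rho t s * theta1 t s * (S * S + C * C))
          by (rewrite E; ring).
        replace (rho t s * theta1 t s * (S * S + C * C)) with
          (C * (rho1 t s * S + rho t s * (theta1 t s * C)) -
           S * (rho1 t s * C - rho t s * (theta1 t s * S))) by ring.
        rewrite Hx, Hy; ring.
    + intros s r Hx Hy Hz.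
      destruct (polar_coordinates_unique _ _ _ _ (Hpos t s Ht) (Hpos t r Ht) Hx Hy) as [Hr [j Hj]].
      eapply Hinj; eauto.
Qed.

Lemma C1_2d_combination (p q f f1 g g1 : R -> R) :
  (forall t, continuous p t) -> (forall t, continuous q t) ->
  (forall s, is_derive f s (f1 s)) -> (forall s, continuous f1 s) ->
  (forall s, is_derive g s (g1 s)) -> (forall s, continuous g1 s) ->
  C1_2d (fun t s => p t * f s + q t * g s) (fun t s => p t * f1 s + q t * g1 s).
Proof.
  intros Cp Cq Df Cf Dg Cg.
  assert (H1 : forall h : R -> R, (forall t, continuous h t) -> forall t s,
    continuity_2d_pt (fun u _ => h u) t s).
  { intros h Hh t s; apply (continuity_1d_2d_pt_comp h (fun u _ => u));
    [apply continuity_pt_filterlim, Hh | apply continuity_2d_pt_id1]. }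
  assert (H2 : forall h : R -> R, (forall s, continuous h s) -> forall t s,
    continuity_2d_pt (fun _ v => h v) t s).
  { intros h Hh t s; apply (continuity_1d_2d_pt_comp h (fun _ v => v));
    [apply continuity_pt_filterlim, Hh | apply continuity_2d_pt_id2]. }
  split; [|split].
  - intros t s; apply (is_derive_plus (fun v => p t * f v) (fun v => q t * g v));
    [apply (is_derive_scal f) | apply (is_derive_scal g)]; auto.
  - intros t s; apply continuity_2d_pt_plus; apply continuity_2d_pt_mult; auto;
    apply H2; intros v; [apply (ex_derive_continuous f); exists (f1 v)
                        |apply (ex_derive_continuous g); exists (g1 v)]; auto.
  - intros t s; apply continuity_2d_pt_plus; apply continuity_2d_pt_mult; auto.
Qed.

Lemma C1_2d_interpolation (a a1 b b1 : R -> R) :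
  (forall s, is_derive a s (a1 s)) -> (forall s, continuous a1 s) ->
  (forall s, is_derive b s (b1 s)) -> (forall s, continuous b1 s) ->
  C1_2d (fun t s => (1 - t) * a s + t * b s) (fun t s => (1 - t) * a1 s + t * b1 s).
Proof.
  intros; apply (C1_2d_combination (fun t => 1 - t) (fun t => t)); auto.
  - intros t; apply (ex_derive_continuous (fun t => 1 - t)); auto_derive; auto.
  - intros t; apply continuous_id.
Qed.

(* The meridian section of a torus around the z-axis, traversed once by
   [s] in [- PI, PI] from the innermost point to itself. These conditions are
   convex, so that any two profiles are joined by a segment of profiles. *)
Record profile (rho z rho1 z1 : R -> R) : Prop := {
  profile_rho_deriv : forall s, is_derive rho s (rho1 s);
  profile_z_deriv : forall s, is_derive z s (z1 s);
  profile_rho1_cont : forall s, continuous rho1 s;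
  profile_z1_cont : forall s, continuous z1 s;
  profile_rho_periodic : forall s, rho (s + 2 * PI) = rho s;
  profile_z_periodic : forall s, z (s + 2 * PI) = z s;
  profile_rho_even : forall s, rho (- s) = rho s;
  profile_z_odd : forall s, z (- s) = - z s;
  profile_rho_pos : forall s, 0 < rho s;
  profile_rho_decr : forall s, 0 < s < PI -> rho1 s < 0;
  profile_z_pos : forall s, 0 < s < PI -> 0 < z s;
  profile_z1_0 : 0 < z1 0;
  profile_z1_PI : z1 PI < 0
}.

Lemma profile_interpolation (ra za ra1 za1 rb zb rb1 zb1 : R -> R) (t : R) :
  profile ra za ra1 za1 -> profile rb zb rb1 zb1 -> 0 <= t <= 1 ->
  profile (fun s => (1 - t) * ra s + t * rb s) (fun s => (1 - t) * za s + t * zb s)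
          (fun s => (1 - t) * ra1 s + t * rb1 s) (fun s => (1 - t) * za1 s + t * zb1 s).
Proof.
  intros [] [] Ht.
  assert (Hc : forall f g : R -> R, (forall s, continuous f s) -> (forall s, continuous g s) ->
    forall s, continuous (fun v => (1 - t) * f v + t * g v) s).
  { intros f g Hf Hg s.
    apply (continuous_plus (fun v => (1 - t) * f v) (fun v => t * g v));
    [apply (continuous_scal_r (1 - t) f) | apply (continuous_scal_r t g)]; auto. }
  assert (Hd : forall f f1 g g1 : R -> R, (forall s, is_derive f s (f1 s)) ->
    (forall s, is_derive g s (g1 s)) ->
    forall s, is_derive (fun v => (1 - t) * f v + t * g v) s ((1 - t) * f1 s + t * g1 s)).
  { intros f f1 g g1 Hf Hg s.
    apply (is_derive_plus (fun v => (1 - t) * f v) (fun v => t * g v));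
    [apply (is_derive_scal f) | apply (is_derive_scal g)]; auto. }
  assert (Hp : forall u v, 0 < u -> 0 < v -> 0 < (1 - t) * u + t * v) by (intros; nra).
  split; auto.
  - intros s; rewrite profile_rho_periodic0, profile_rho_periodic1; reflexivity.
  - intros s; rewrite profile_z_periodic0, profile_z_periodic1; reflexivity.
  - intros s; rewrite profile_rho_even0, profile_rho_even1; reflexivity.
  - intros s; rewrite profile_z_odd0, profile_z_odd1; ring.
  - intros s Hs; pose proof (profile_rho_decr0 s Hs); pose proof (profile_rho_decr1 s Hs); nra.
  - nra.
Qed.

Lemma decreasing_of_derive (f f1 : R -> R) (a b : R) :
  (forall s, is_derive f s (f1 s)) -> (forall s, a < s < b -> f1 s < 0) ->
  forall s t, a <= s -> s < t -> t <= b -> f t < f s.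
Proof.
  intros Hd Hn s t Has Hst Htb.
  destruct (MVT_cor2 f f1 s t Hst) as [c [Hc Hcst]]; [intros; apply is_derive_Reals, Hd |].
  pose proof (Hn c ltac:(lra)); nra.
Qed.

(** Modulo [2 * PI] both parameters lie between [- PI] and [PI]. The sign of [z] tells the lower
    half of the section from the upper one, and on each half [rho] is strictly monotone. *)
Lemma profile_injective (rho z rho1 z1 : R -> R) (s t : R) :
  profile rho z rho1 z1 -> rho s = rho t -> z s = z t ->
  exists k : Z, s - t = IZR k * (2 * PI).
Proof.
  intros [] Hr Hz; pose proof PI_RGT_0 as HPI.
  assert (Hred : forall r, exists k : Z, - PI < r - IZR k * (2 * PI) <= PI).
  { intros r; destruct (exists_period (2 * PI) ltac:(lra) (PI - r)) as [k Hk].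
    exists (- k)%Z; rewrite opp_IZR; lra. }
  destruct (Hred s) as [k Hk]; destruct (Hred t) as [j Hj].
  assert (Hp : forall (f : R -> R) r i, (forall u, f (u + 2 * PI) = f u) ->
    f r = f (r - IZR i * (2 * PI))).
  { intros f r i Hf; rewrite <- (periodic_Z f (2 * PI) Hf i (r - IZR i * (2 * PI))); f_equal; ring. }
  rewrite (Hp rho s k), (Hp rho t j) in Hr by assumption.
  rewrite (Hp z s k), (Hp z t j) in Hz by assumption.
  exists (k - j)%Z; rewrite minus_IZR.
  assert (E : s - IZR k * (2 * PI) = t - IZR j * (2 * PI)); [|lra].
  set (a := s - IZR k * (2 * PI)) in *; set (b := t - IZR j * (2 * PI)) in *.
  clearbody a b; clear Hp Hred s t k j.
  pose proof (decreasing_of_derive rho rho1 0 PI profile_rho_deriv0 profile_rho_decr0) as Hdec.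
  assert (Hz0 : z 0 = 0) by (pose proof (profile_z_odd0 0) as H; rewrite Ropp_0 in H; lra).
  assert (HzPI : z PI = 0).
  { pose proof (profile_z_odd0 PI) as H; pose proof (profile_z_periodic0 (- PI)) as H1.
    replace (- PI + 2 * PI) with PI in H1 by ring; lra. }
  assert (Hnn : forall u, 0 <= u <= PI -> 0 <= z u).
  { intros u Hu; destruct (Req_dec u 0) as [->|]; [lra |];
    destruct (Req_dec u PI) as [->|]; [lra |]; left; apply profile_z_pos0; lra. }
  assert (Hneg : forall u, - PI < u < 0 -> z u < 0).
  { intros u Hu; pose proof (profile_z_pos0 (- u) ltac:(lra)); rewrite profile_z_odd0 in *; lra. }
  assert (Hin : forall u v, 0 <= u <= PI -> 0 <= v <= PI -> rho u = rho v -> u = v).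
  { intros u v Hu Hv Huv; destruct (Rtotal_order u v) as [H|[H|H]]; [|exact H|].
    - pose proof (Hdec u v ltac:(lra) H ltac:(lra)); lra.
    - pose proof (Hdec v u ltac:(lra) H ltac:(lra)); lra. }
  destruct (Rlt_le_dec a 0) as [Ha|Ha]; destruct (Rlt_le_dec b 0) as [Hb|Hb].
  - assert (- a = - b); [|lra].
    apply Hin; [lra | lra |]; rewrite !profile_rho_even0; exact Hr.
  - pose proof (Hneg a ltac:(lra)); pose proof (Hnn b ltac:(lra)); lra.
  - pose proof (Hneg b ltac:(lra)); pose proof (Hnn a ltac:(lra)); lra.
  - apply Hin; [lra | lra | exact Hr].
Qed.

(** Since [rho1] is odd and negative between 0 and [PI], it can vanish only at the outermost and
    innermost points, and there [z1] is nonzero. *)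
Lemma profile_immersed (rho z rho1 z1 : R -> R) (s : R) :
  profile rho z rho1 z1 -> rho1 s = 0 -> z1 s = 0 -> False.
Proof.
  intros [] Hr Hz; pose proof PI_RGT_0 as HPI.
  destruct (exists_period (2 * PI) ltac:(lra) (PI - s)) as [k Hk].
  assert (Hp : forall f f1 : R -> R, (forall u, is_derive f u (f1 u)) ->
    (forall u, f (u + 2 * PI) = f u) -> f1 (s + IZR k * (2 * PI)) = f1 s).
  { intros f f1 Hd Hf; apply periodic_Z; exact (is_derive_periodic f f1 (2 * PI) Hd Hf). }
  rewrite <- (Hp rho rho1) in Hr by assumption; rewrite <- (Hp z z1) in Hz by assumption.
  set (a := s + IZR k * (2 * PI)) in *.
  assert (Ha : - PI < a <= PI) by (unfold a; lra).
  assert (Hodd : rho1 (- a) = - rho1 a).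
  { assert (H : is_derive rho a (- 1 * rho1 (- a))).
    { apply is_derive_ext with (fun t => rho (- t)); [exact profile_rho_even0 |].
      apply (is_derive_comp rho (fun t => - t)); [auto | auto_derive; auto; ring]. }
    apply is_derive_unique in H; rewrite (is_derive_unique _ _ _ (profile_rho_deriv0 a)) in H.
    lra. }
  destruct (Req_dec a PI) as [E|]; [rewrite E in Hz; lra |].
  destruct (Rtotal_order a 0) as [H1|[H1|H1]].
  - pose proof (profile_rho_decr0 (- a) ltac:(lra)); lra.
  - rewrite H1 in Hz; lra.
  - pose proof (profile_rho_decr0 a ltac:(lra)); lra.
Qed.

(** * Angle functions with a prescribed slope, and curves winding over a profile *)

Record winding (slope : R) (theta theta1 : R -> R) : Prop := {
  winding_deriv : forall s, is_derive theta s (theta1 s);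
  winding_cont : forall s, continuous theta1 s;
  winding_slope : forall s, theta (s + 2 * PI) = theta s + slope * (2 * PI)
}.

Lemma winding_Z (slope : R) (theta theta1 : R -> R) (k : Z) (s : R) :
  winding slope theta theta1 ->
  theta (s + IZR k * (2 * PI)) = theta s + slope * (IZR k * (2 * PI)).
Proof.
  intros [_ _ Hw].
  assert (H : theta (s + IZR k * (2 * PI)) - slope * (s + IZR k * (2 * PI)) = theta s - slope * s);
    [|lra].
  apply (periodic_Z (fun t => theta t - slope * t)); intros t; rewrite Hw; ring.
Qed.

(** If [k] meridian turns bring the angle back after [j] turns around the axis, then [m k = n j],
    and [n] divides [k] by Gauss. The sign of [n] goes into [i], as periods are counted with
    [Z.abs n]. *)
Lemma coprime_slope_period (m n k j : Z) :
  n <> 0%Z -> Z.gcd m n = 1%Z -> IZR m / IZR n * IZR k = IZR j ->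
  exists i : Z, IZR k = IZR i * IZR (Z.abs n).
Proof.
  intros hn hmn H.
  assert (Hn : IZR n <> 0) by (apply not_0_IZR; exact hn).
  assert (E : (m * k = n * j)%Z).
  { apply eq_IZR; rewrite !mult_IZR, <- H; field; exact Hn. }
  assert (Hdiv : (n | k)%Z).
  { apply (Znumtheory.Gauss n m k); [exists j; lia |].
    apply Znumtheory.Zgcd_1_rel_prime; rewrite Z.gcd_comm; exact hmn. }
  destruct Hdiv as [i ->]; exists (i * Z.sgn n)%Z.
  rewrite <- mult_IZR; f_equal; rewrite <- Z.mul_assoc; f_equal; lia.
Qed.

Lemma winding_period_pos (n : Z) : n <> 0%Z -> 0 < IZR (Z.abs n) * (2 * PI).
Proof.
  intros hn; pose proof PI_RGT_0; apply Rmult_lt_0_compat; [|lra].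
  apply IZR_lt; lia.
Qed.

Lemma profile_curve_injective (m n : Z) (rho z rho1 z1 theta theta1 : R -> R) (s r : R) (j : Z) :
  n <> 0%Z -> Z.gcd m n = 1%Z ->
  profile rho z rho1 z1 -> winding (IZR m / IZR n) theta theta1 ->
  rho s = rho r -> z s = z r -> theta s - theta r = IZR j * (2 * PI) ->
  exists i : Z, s - r = IZR i * (IZR (Z.abs n) * (2 * PI)).
Proof.
  intros hn hmn Hp Hw Hr Hz Hth; pose proof PI_RGT_0.
  destruct (profile_injective _ _ _ _ s r Hp Hr Hz) as [k Hk].
  assert (Hth2 : theta s = theta r + IZR m / IZR n * (IZR k * (2 * PI))).
  { rewrite <- (winding_Z _ _ _ k r Hw), <- Hk; f_equal; ring. }
  destruct (coprime_slope_period m n k j hn hmn) as [i Hi].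
  - apply Rmult_eq_reg_r with (2 * PI); [|lra]; rewrite <- Hth, Hth2; ring.
  - exists i; rewrite Hk, Hi; ring.
Qed.

(** Radius, angle and height are interpolated separately. Profiles form a convex set and angle
    functions of a given slope an affine one, so each intermediate curve winds in the same way on an
    intermediate torus, and coprimality keeps it simple. *)
Theorem same_knot_type_profile (m n : Z)
    (ra za ra1 za1 rb zb rb1 zb1 tha tha1 thb thb1 : R -> R) :
  n <> 0%Z -> Z.gcd m n = 1%Z ->
  profile ra za ra1 za1 -> profile rb zb rb1 zb1 ->
  winding (IZR m / IZR n) tha tha1 -> winding (IZR m / IZR n) thb thb1 ->
  same_knot_type (image (cyl ra tha za)) (image (cyl rb thb zb)).
Proof.
  intros hn hmn Pa Pb Wa Wb.
  assert (Hn : IZR n <> 0) by (apply not_0_IZR; exact hn).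
  set (mix := fun (f g : R -> R) t s => (1 - t) * f s + t * g s).
  assert (Wt : forall t, winding (IZR m / IZR n) (mix tha thb t) (mix tha1 thb1 t)).
  { destruct Wa as [Da Ca Sa], Wb as [Db Cb Sb]; intros t; split; intros s; unfold mix.
    - apply (is_derive_plus (fun v => (1 - t) * tha v) (fun v => t * thb v));
      [apply (is_derive_scal tha) | apply (is_derive_scal thb)]; auto.
    - apply (continuous_plus (fun v => (1 - t) * tha1 v) (fun v => t * thb1 v));
      [apply (continuous_scal_r (1 - t) tha1) | apply (continuous_scal_r t thb1)]; auto.
    - rewrite Sa, Sb; ring. }
  apply same_knot_type_ext with (image (cyl (mix ra rb 0) (mix tha thb 0) (mix za zb 0)))
                                (image (cyl (mix ra rb 1) (mix tha thb 1) (mix za zb 1))).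
  { intros p; split; intros [s <-]; exists s; unfold cyl, mix; f_equal;
    rewrite ?Rminus_0_r, ?Rmult_0_l, ?Rmult_1_l, ?Rplus_0_r; reflexivity. }
  { intros p; split; intros [s <-]; exists s; unfold cyl, mix; f_equal;
    rewrite ?Rminus_diag_eq, ?Rmult_0_l, ?Rmult_1_l, ?Rplus_0_l by reflexivity; reflexivity. }
  assert (Pt : forall t, 0 <= t <= 1 ->
    profile (mix ra rb t) (mix za zb t) (mix ra1 rb1 t) (mix za1 zb1 t)).
  { intros t Ht; apply profile_interpolation; assumption. }
  assert (Hmix : forall (f g : R -> R), (forall s, f (s + 2 * PI) = f s) ->
    (forall s, g (s + 2 * PI) = g s) ->
    forall t s, mix f g t (s + IZR (Z.abs n) * (2 * PI)) = mix f g t s).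
  { intros f g Hf Hg t s; unfold mix; rewrite !(periodic_Z _ _ Hf), !(periodic_Z _ _ Hg); easy. }
  (* In [|n|] meridian turns the angle makes [(m / n) |n| = m sgn n] turns. *)
  apply (same_knot_type_cyl_family (IZR (Z.abs n) * (2 * PI)) (m * Z.sgn n)
    (mix ra rb) (mix tha thb) (mix za zb) (mix ra1 rb1) (mix tha1 thb1) (mix za1 zb1)).
  - apply winding_period_pos, hn.
  - destruct Pa, Pb; apply C1_2d_interpolation; auto.
  - destruct Wa, Wb; apply C1_2d_interpolation; auto.
  - destruct Pa, Pb; apply C1_2d_interpolation; auto.
  - destruct Pa, Pb; apply Hmix; auto.
  - destruct Pa, Pb; apply Hmix; auto.
  - intros t s; rewrite (winding_Z _ _ _ _ s (Wt t)); f_equal.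
    assert (Hs : IZR (Z.abs n) = IZR n * IZR (Z.sgn n)) by (rewrite <- mult_IZR; f_equal; lia).
    rewrite mult_IZR, Hs; field; exact Hn.
  - intros t s Ht; apply (profile_rho_pos _ _ _ _ (Pt t Ht)).
  - intros t s Ht Hr _ Hz; exact (profile_immersed _ _ _ _ s (Pt t Ht) Hr Hz).
  - intros t s r j Ht Hr Hz Hth.
    exact (profile_curve_injective m n _ _ _ _ _ _ s r j hn hmn (Pt t Ht) (Wt t) Hr Hz Hth).
Qed.

(** * Torus curves *)

Lemma continuous_of_derivable (f : R -> R) (s : R) : ex_derive f s -> continuous f s.
Proof. exact (ex_derive_continuous f s). Qed.

Lemma winding_affine (slope c : R) : winding slope (fun s => slope * s + c) (fun _ => slope).
Proof.
  split; intros s; [auto_derive; auto; ring | apply continuous_const | ring].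
Qed.

Lemma profile_circle (a r : R) :
  0 < r -> r < a ->
  profile (fun s => a + r * cos s) (fun s => r * sin s)
          (fun s => - (r * sin s)) (fun s => r * cos s).
Proof.
  intros hr hra; split; try (intros s).
  - auto_derive; auto; ring.
  - auto_derive; auto; ring.
  - apply continuous_of_derivable; auto_derive; auto.
  - apply continuous_of_derivable; auto_derive; auto.
  - rewrite cos_plus, cos_2PI, sin_2PI; ring.
  - rewrite sin_plus, cos_2PI, sin_2PI; ring.
  - rewrite cos_neg; reflexivity.
  - rewrite sin_neg; ring.
  - pose proof (COS_bound s); nra.
  - intros Hs; pose proof (sin_gt_0 s ltac:(lra) ltac:(lra)); nra.
  - intros Hs; pose proof (sin_gt_0 s ltac:(lra) ltac:(lra)); nra.
  - rewrite cos_0; lra.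
  - rewrite cos_PI; lra.
Qed.

Lemma image_reparametrization (c c' : R -> R3) (f g : R -> R) :
  (forall s, c s = c' (f s)) -> (forall s, f (g s) = s) ->
  forall p, image c p <-> image c' p.
Proof.
  intros Hc Hfg p; split; intros [s <-].
  - exists (f s); symmetry; apply Hc.
  - exists (g s); rewrite Hc, Hfg; reflexivity.
Qed.

Lemma torus_curve_image (a r : R) (m n : Z) :
  n <> 0%Z -> forall p, image (torus_curve a r m n) p <->
    image (cyl (fun s => a + r * cos s) (fun s => IZR m / IZR n * s + 0) (fun s => r * sin s)) p.
Proof.
  intros hn; assert (Hn : IZR n <> 0) by (apply not_0_IZR; exact hn).
  apply image_reparametrization with (fun t => IZR n * t) (fun s => s / IZR n).
  - intros s; unfold torus_curve, cyl.
    replace (IZR m / IZR n * (IZR n * s) + 0) with (IZR m * s) by (field; exact Hn); reflexivity.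
  - intros s; field; exact Hn.
Qed.

(* With longitudinal winding number [1] or [-1] the curve is a graph over the
   angle around the axis, so the number of meridian turns is irrelevant. *)
Lemma same_knot_type_longitude (m : Z) (a r : R) :
  Z.abs m = 1%Z -> 0 < r -> r < a ->
  same_knot_type
    (image (cyl (fun s => a + r * cos s) (fun s => IZR m / 1 * s + 0) (fun s => r * sin s)))
    (image (cyl (fun s => a + r * cos s) (fun s => IZR m / 2 * s + 0) (fun s => r * sin s))).
Proof.
  intros hm hr hra; pose proof PI_RGT_0.
  assert (hm2 : IZR m * IZR m = 1) by (rewrite <- mult_IZR; f_equal; nia).
  (* Both curves are parametrized with angle [m s] around the axis; only the position within the
     meridian half-plane is interpolated, from one turn to two. *)
  set (rho := fun t s => (1 - t) * (a + r * cos s) + t * (a + r * cos (2 * s))).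
  set (z := fun t s => (1 - t) * (r * sin s) + t * (r * sin (2 * s))).
  set (theta := fun (t s : R) => (1 - t) * (IZR m * s) + t * (IZR m * s)).
  apply same_knot_type_ext with (image (cyl (rho 0) (theta 0) (z 0)))
                                (image (cyl (rho 1) (theta 1) (z 1))).
  { apply image_reparametrization with (fun t => t) (fun t => t); auto.
    intros s; unfold cyl, rho, theta, z; f_equal; rewrite ?Rminus_0_r, ?Rmult_0_l, ?Rmult_1_l,
      ?Rplus_0_r, ?Rdiv_1_r; reflexivity. }
  { apply image_reparametrization with (fun t => 2 * t) (fun t => t / 2); [|intros; field].
    intros s; unfold cyl, rho, theta, z.
    replace (IZR m / 2 * (2 * s) + 0) with (IZR m * s) by field.
    rewrite Rminus_diag_eq, !Rmult_0_l, !Rmult_1_l, !Rplus_0_l by reflexivity; reflexivity. }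
  apply (same_knot_type_cyl_family (2 * PI) m rho theta z
    (fun t s => (1 - t) * (- (r * sin s)) + t * (- (2 * r * sin (2 * s))))
    (fun t s => (1 - t) * IZR m + t * IZR m)
    (fun t s => (1 - t) * (r * cos s) + t * (2 * r * cos (2 * s)))).
  - lra.
  - apply (C1_2d_interpolation (fun s => a + r * cos s) (fun s => - (r * sin s))
      (fun s => a + r * cos (2 * s)) (fun s => - (2 * r * sin (2 * s)))); intros s;
      try (apply continuous_of_derivable); auto_derive; auto; ring.
  - apply (C1_2d_interpolation (fun s => IZR m * s) (fun _ => IZR m)
      (fun s => IZR m * s) (fun _ => IZR m)); intros s;
      try (apply continuous_of_derivable); auto_derive; auto; ring.
  - apply (C1_2d_interpolation (fun s => r * sin s) (fun s => r * cos s)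
      (fun s => r * sin (2 * s)) (fun s => 2 * r * cos (2 * s))); intros s;
      try (apply continuous_of_derivable); auto_derive; auto; ring.
  - intros t s; unfold rho.
    replace (2 * (s + 2 * PI)) with (2 * s + IZR 2 * (2 * PI)) by ring.
    replace (s + 2 * PI) with (s + IZR 1 * (2 * PI)) by ring; rewrite !cos_add_2PI; reflexivity.
  - intros t s; unfold z.
    replace (2 * (s + 2 * PI)) with (2 * s + IZR 2 * (2 * PI)) by ring.
    replace (s + 2 * PI) with (s + IZR 1 * (2 * PI)) by ring; rewrite !sin_add_2PI; reflexivity.
  - intros t s; unfold theta; ring.
  - intros t s Ht; unfold rho; pose proof (COS_bound s); pose proof (COS_bound (2 * s)).
    assert (0 < a + r * cos s) by nra; assert (0 < a + r * cos (2 * s)) by nra.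
    destruct (Req_dec t 0) as [->|]; [lra | nra].
  - intros t s _ _ Hth _; assert (IZR m = 0) by lra; nra.
  - intros t s u j _ _ _ Hth; unfold theta in Hth; exists (m * j)%Z; rewrite mult_IZR.
    replace (s - u) with (IZR m * IZR m * (s - u)) by (rewrite hm2; ring).
    replace (IZR m * IZR m * (s - u)) with (IZR m * (IZR j * (2 * PI))); [ring |].
    rewrite <- Hth; ring.
Qed.

(** * Exchanging the two winding numbers *)

Lemma C1_2d_const_minus (c : R) (f f1 : R -> R -> R) :
  C1_2d f f1 -> C1_2d (fun t s => c - f t s) (fun t s => - f1 t s).
Proof.
  intros [Df [Cf Cf1]]; split; [|split]; intros t s.
  - replace (- f1 t s) with (0 - f1 t s) by ring.
    apply (is_derive_minus (fun _ => c) (f t)); [apply (is_derive_const c) | apply Df].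
  - apply continuity_2d_pt_minus; [apply continuity_2d_pt_const | apply Cf].
  - apply continuity_2d_pt_opp, Cf1.
Qed.

Lemma C1_family_div (L : R) (f f1 g g1 : R -> R -> R) :
  C1_2d f f1 -> C1_2d g g1 -> (forall t s, g t s <> 0) ->
  (forall t s, f t (s + L) = f t s) -> (forall t s, g t (s + L) = g t s) ->
  C1_family L (fun t s => f t s / g t s)
    (fun t s => (f1 t s * g t s - f t s * g1 t s) / (g t s * g t s)).
Proof.
  intros [Df [Cf Cf1]] [Dg [Cg Cg1]] Hg Pf Pg; split; [|split]; intros t s.
  - replace (g t s * g t s) with (g t s ^ 2) by ring.
    apply (is_derive_div (f t) (g t)); auto.
  - apply continuity_2d_pt_mult.
    + apply continuity_2d_pt_minus; apply continuity_2d_pt_mult; auto.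
    + apply continuity_2d_pt_inv; [apply continuity_2d_pt_mult; auto |].
      apply Rmult_integral_contrapositive; auto.
  - rewrite Pf, Pg; reflexivity.
Qed.

(* Stereographic projection of the torus |z1| = |z2| = 1 in the sphere of
   radius sqrt 2 of C^2, from the pole (0, sqrt 2). *)
Lemma profile_clifford :
  profile (fun s => 1 / (sqrt 2 - cos s)) (fun s => sin s / (sqrt 2 - cos s))
          (fun s => - sin s / (sqrt 2 - cos s) ^ 2)
          (fun s => (sqrt 2 * cos s - 1) / (sqrt 2 - cos s) ^ 2).
Proof.
  assert (Hsq : 1 < sqrt 2) by (rewrite <- sqrt_1 at 1; apply sqrt_lt_1; lra).
  assert (HD : forall s, 0 < sqrt 2 - cos s) by (intros s; pose proof (COS_bound s); lra).
  assert (HD1 : forall s, sqrt 2 - cos s <> 0) by (intros s; pose proof (HD s); lra).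
  assert (HD2 : forall s, 0 < (sqrt 2 - cos s) ^ 2) by (intros s; apply pow_lt, HD).
  split; try (intros s).
  - auto_derive; [repeat split; apply HD1 |]; field; apply HD1.
  - auto_derive; [repeat split; apply HD1 |]; pose proof (sin2_cos2 s) as E; unfold Rsqr in E.
    field_simplify_eq; [|apply HD1].
    replace (sin s ^ 2) with (1 - cos s ^ 2) by lra; ring.
  - apply continuous_of_derivable; auto_derive; apply Rgt_not_eq, (HD2 s).
  - apply continuous_of_derivable; auto_derive; apply Rgt_not_eq, (HD2 s).
  - rewrite cos_plus, cos_2PI, sin_2PI; f_equal; f_equal; ring.
  - rewrite sin_plus, cos_plus, cos_2PI, sin_2PI; f_equal; [ring | f_equal; f_equal; ring].
  - rewrite cos_neg; reflexivity.
  - rewrite cos_neg, sin_neg; field; auto.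
  - apply Rdiv_lt_0_compat; auto; lra.
  - intros Hs; pose proof (sin_gt_0 s ltac:(lra) ltac:(lra)).
    assert (0 < sin s / (sqrt 2 - cos s) ^ 2) by (apply Rdiv_lt_0_compat; auto).
    unfold Rdiv in *; lra.
  - intros Hs; apply Rdiv_lt_0_compat; auto; apply sin_gt_0; lra.
  - apply Rdiv_lt_0_compat; auto; rewrite cos_0; lra.
  - assert (0 < (1 + sqrt 2) / (sqrt 2 - cos PI) ^ 2) by (apply Rdiv_lt_0_compat; auto; lra).
    rewrite cos_PI in *; unfold Rdiv in *; lra.
Qed.

(* With these phases the rotated torus knot never meets the pole. *)
Lemma rotated_torus_knot_avoids_pole (m n : Z) (A B s : R) :
  m <> 0%Z -> A * A + B * B = 1 ->
  B * cos (IZR m * s) + A * cos (IZR n * s + PI / (2 * IZR m)) < sqrt 2.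
Proof.
  intros hm HAB; apply Rnot_le_lt; intros H.
  set (u := IZR m * s) in *; set (v := IZR n * s + PI / (2 * IZR m)) in *.
  pose proof (sin2_cos2 u) as Eu; pose proof (sin2_cos2 v) as Ev; unfold Rsqr in *.
  pose proof (sqrt_sqrt 2 ltac:(lra)) as E2; pose proof (sqrt_pos 2).
  assert (H2 : 2 <= (B * cos u + A * cos v) * (B * cos u + A * cos v)) by nra.
  (* Lagrange's identity: the value [sqrt 2] can only be reached with both cosines equal to 1 or
     -1. *)
  assert (E : (B * cos u + A * cos v) * (B * cos u + A * cos v) +
              (A * cos u - B * cos v) * (A * cos u - B * cos v) =
              (A * A + B * B) * (cos u * cos u + cos v * cos v)) by ring.
  rewrite HAB in E.
  pose proof (Rle_0_sqr (A * cos u - B * cos v)) as H3; unfold Rsqr in H3.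
  assert (H4 : sin u * sin u + sin v * sin v <= 0) by lra.
  assert (Su : sin u = 0) by nra; assert (Sv : sin v = 0) by nra.
  destruct (sin_eq_0_0 u Su) as [k Hk]; destruct (sin_eq_0_0 v Sv) as [l Hl].
  assert (Hm : IZR m <> 0) by (apply not_0_IZR; exact hm); pose proof PI_RGT_0.
  (* From [u = k PI] and [v = l PI], eliminating [s] makes the phase [PI / (2 m)] contribute an odd
     unit: an odd number would equal an even one. *)
  assert (Ez : (2 * n * k + 1 = 2 * l * m)%Z); [|lia].
  apply eq_IZR; rewrite plus_IZR, !mult_IZR; apply Rmult_eq_reg_r with PI; [|lra].
  replace (2 * IZR l * IZR m * PI) with (2 * IZR m * (IZR l * PI)) by ring; rewrite <- Hl.
  replace ((2 * IZR n * IZR k + 1) * PI) with (2 * IZR n * (IZR k * PI) + PI) by ring.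
  rewrite <- Hk; unfold u, v; field; exact Hm.
Qed.

(* Rotate the Clifford torus in C^2 by (z1, z2) |-> (A z1 - B z2, B z1 + A z2),
   where (A, B) runs from (1, 0) to (0, 1), so that the two factors get
   exchanged, and project stereographically. *)
Theorem same_knot_type_swap (m n : Z) :
  m <> 0%Z -> n <> 0%Z -> Z.gcd m n = 1%Z ->
  exists c1 c2 : R,
  same_knot_type
    (image (cyl (fun s => 1 / (sqrt 2 - cos s)) (fun s => IZR m / IZR n * s + c1)
                (fun s => sin s / (sqrt 2 - cos s))))
    (image (cyl (fun s => 1 / (sqrt 2 - cos s)) (fun s => IZR n / IZR m * s + c2)
                (fun s => sin s / (sqrt 2 - cos s)))).
Proof.
  intros hm hn hmn; pose proof PI_RGT_0.
  assert (Hm : IZR m <> 0) by (apply not_0_IZR; exact hm).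
  assert (Hn : IZR n <> 0) by (apply not_0_IZR; exact hn).
  set (delta := PI / (2 * IZR m)).
  (* At the start the meridian angle is [n s + delta] and the angle around the axis [m s]; rewriting
     the latter in terms of the former gives the first phase. At the end the meridian angle is [m s]
     and the first complex coordinate is [- z2], which adds [PI] to [n s + delta]. *)
  exists (- (IZR m / IZR n * delta)), (delta + PI).
  set (A := fun t => cos (t * (PI / 2))); set (B := fun t => sin (t * (PI / 2))).
  set (A' := fun t => - B t).
  set (c := fun s => cos (IZR m * s)); set (s1 := fun s => sin (IZR m * s)).
  set (d := fun s => cos (IZR n * s + delta)); set (s2 := fun s => sin (IZR n * s + delta)).
  set (c' := fun s => - (IZR m * s1 s)); set (s1' := fun s => IZR m * c s).
  set (d' := fun s => - (IZR n * s2 s)); set (s2' := fun s => IZR n * d s).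
  set (X := fun t s => A t * c s + A' t * d s); set (X1 := fun t s => A t * c' s + A' t * d' s).
  set (Y := fun t s => A t * s1 s + A' t * s2 s); set (Y1 := fun t s => A t * s1' s + A' t * s2' s).
  set (Z := fun t s => B t * s1 s + A t * s2 s); set (Z1 := fun t s => B t * s1' s + A t * s2' s).
  set (W := fun t s => B t * c s + A t * d s); set (W1 := fun t s => B t * c' s + A t * d' s).
  set (D := fun t s => sqrt 2 - W t s); set (D1 := fun t s => - W1 t s).
  assert (EAB : forall t, A t * A t + B t * B t = 1).
  { intros t; pose proof (sin2_cos2 (t * (PI / 2))); unfold A, B, Rsqr in *; lra. }
  assert (Ecs : forall s, c s * c s + s1 s * s1 s = 1 /\ d s * d s + s2 s * s2 s = 1).
  { intros s; pose proof (sin2_cos2 (IZR m * s)); pose proof (sin2_cos2 (IZR n * s + delta)).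
    unfold c, d, s1, s2, Rsqr in *; lra. }
  assert (HD : forall t s, 0 < D t s).
  { intros t s; pose proof (rotated_torus_knot_avoids_pole m n (A t) (B t) s hm (EAB t)).
    unfold D, W, c, d, delta in *; lra. }
  assert (HD0 : forall t s, D t s <> 0) by (intros t s; pose proof (HD t s); lra).
  assert (Hcont : (forall t, continuous A t) /\ (forall t, continuous B t) /\
                  (forall t, continuous A' t)).
  { repeat split; intros t; apply continuous_of_derivable; unfold A', A, B; auto_derive; auto. }
  destruct Hcont as [CA [CB CA']].
  assert (C2 : C1_2d X X1 /\ C1_2d Y Y1 /\ C1_2d Z Z1 /\ C1_2d W W1).
  { split; [|split; [|split]]; apply C1_2d_combination; auto; intros s;
    try apply continuous_of_derivable; unfold c', s1', d', s2', c, d, s1, s2; auto_derive; auto; ring. }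
  destruct C2 as [CX [CY [CZ CW]]].
  assert (CD : C1_2d D D1) by (apply C1_2d_const_minus; exact CW).
  assert (Eper : forall s, c (s + 2 * PI) = c s /\ s1 (s + 2 * PI) = s1 s /\
                           d (s + 2 * PI) = d s /\ s2 (s + 2 * PI) = s2 s).
  { intros s; unfold c, s1, d, s2.
    replace (IZR m * (s + 2 * PI)) with (IZR m * s + IZR m * (2 * PI)) by ring.
    replace (IZR n * (s + 2 * PI) + delta) with (IZR n * s + delta + IZR n * (2 * PI)) by ring.
    rewrite !cos_add_2PI, !sin_add_2PI; auto. }
  assert (Pper : forall t s, X t (s + 2 * PI) = X t s /\ Y t (s + 2 * PI) = Y t s /\
                             Z t (s + 2 * PI) = Z t s /\ D t (s + 2 * PI) = D t s).
  { intros t s; destruct (Eper s) as [E1 [E2 [E3 E4]]]; unfold X, Y, Z, D, W.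
    rewrite E1, E2, E3, E4; auto. }
  assert (Esph : forall t s, X t s * X t s + Y t s * Y t s + Z t s * Z t s + W t s * W t s = 2).
  { intros t s; destruct (Ecs s) as [E1 E2].
    replace 2 with ((A t * A t + B t * B t) * (c s * c s + s1 s * s1 s) +
      (A t * A t + B t * B t) * (d s * d s + s2 s * s2 s)) by (rewrite E1, E2, EAB; ring).
    unfold X, Y, Z, W, A'; ring. }
  assert (E2 : sqrt 2 * sqrt 2 = 2) by (apply sqrt_sqrt; lra).
  apply same_knot_type_ext with
    (image (fun s => mk3 (X 0 s / D 0 s) (Y 0 s / D 0 s) (Z 0 s / D 0 s)))
    (image (fun s => mk3 (X 1 s / D 1 s) (Y 1 s / D 1 s) (Z 1 s / D 1 s))).
  { apply image_reparametrization with (fun s => IZR n * s + delta)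
      (fun s => (s - delta) / IZR n); [|intros s; field; exact Hn].
    intros s; unfold cyl.
    replace (IZR m / IZR n * (IZR n * s + delta) + - (IZR m / IZR n * delta)) with (IZR m * s)
      by (field; exact Hn).
    assert (E0 : A 0 = 1 /\ B 0 = 0) by (unfold A, B; rewrite Rmult_0_l, cos_0, sin_0; auto).
    destruct E0 as [E0 E0']; unfold X, Y, Z, D, W, A'; rewrite E0, E0'.
    unfold c, s1, d, s2; apply R3_eq; cbn [cx cy cz mk3 fst snd];
      rewrite ?Ropp_0, ?Rmult_0_l, ?Rmult_1_l, ?Rplus_0_l, ?Rplus_0_r; unfold Rdiv; ring. }
  { apply image_reparametrization with (fun s => IZR m * s) (fun s => s / IZR m);
      [|intros s; field; exact Hm].
    intros s; unfold cyl.
    replace (IZR n / IZR m * (IZR m * s) + (delta + PI)) with (IZR n * s + delta + PI)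
      by (field; exact Hm).
    rewrite neg_cos, neg_sin.
    assert (E0 : A 1 = 0 /\ B 1 = 1) by (unfold A, B; rewrite Rmult_1_l, cos_PI2, sin_PI2; auto).
    destruct E0 as [E0 E0']; unfold X, Y, Z, D, W, A'; rewrite E0, E0'.
    unfold c, s1, d, s2; apply R3_eq; cbn [cx cy cz mk3 fst snd];
      rewrite ?Ropp_0, ?Rmult_0_l, ?Rmult_1_l, ?Rplus_0_l, ?Rplus_0_r; unfold Rdiv; ring. }
  apply (same_knot_type_family (2 * PI)
    (fun t s => X t s / D t s) (fun t s => Y t s / D t s) (fun t s => Z t s / D t s)
    (fun t s => (X1 t s * D t s - X t s * D1 t s) / (D t s * D t s))
    (fun t s => (Y1 t s * D t s - Y t s * D1 t s) / (D t s * D t s))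
    (fun t s => (Z1 t s * D t s - Z t s * D1 t s) / (D t s * D t s))).
  - lra.
  - apply C1_family_div; auto; apply Pper.
  - apply C1_family_div; auto; apply Pper.
  - apply C1_family_div; auto; apply Pper.
  - intros t _; split.
    + intros s Hx Hy Hz.
      assert (Hnum : forall a, a / (D t s * D t s) = 0 -> a = 0).
      { intros a Ha; replace a with (a / (D t s * D t s) * (D t s * D t s)) by (field; auto).
        rewrite Ha; ring. }
      apply Hnum in Hx; apply Hnum in Hy; apply Hnum in Hz.
      assert (Hor : X t s * X1 t s + Y t s * Y1 t s + Z t s * Z1 t s + W t s * W1 t s = 0).
      { replace (X t s * X1 t s + Y t s * Y1 t s + Z t s * Z1 t s + W t s * W1 t s) with
          ((A t * A t + B t * B t) * (c s * c' s + s1 s * s1' s) +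
           (A t * A t + B t * B t) * (d s * d' s + s2 s * s2' s)) by
          (unfold X, Y, Z, W, X1, Y1, Z1, W1, A'; ring).
        unfold c', s1', d', s2'; ring. }
      assert (Hsp : X1 t s * X1 t s + Y1 t s * Y1 t s + Z1 t s * Z1 t s + W1 t s * W1 t s =
                    IZR m * IZR m + IZR n * IZR n).
      { destruct (Ecs s) as [Q1 Q2].
        replace (IZR m * IZR m + IZR n * IZR n) with
          ((A t * A t + B t * B t) * (IZR m * IZR m) * (c s * c s + s1 s * s1 s) +
           (A t * A t + B t * B t) * (IZR n * IZR n) * (d s * d s + s2 s * s2 s))
          by (rewrite Q1, Q2, EAB; ring).
        unfold X1, Y1, Z1, W1, A', c', s1', d', s2'; ring. }
      pose proof (Esph t s) as Hs; pose proof (HD t s) as HDts.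
      assert (HDW : D t s = sqrt 2 - W t s) by reflexivity.
      assert (HD1W : D1 t s = - W1 t s) by reflexivity.
      set (x := X t s) in *; set (y := Y t s) in *; set (z := Z t s) in *; set (w := W t s) in *.
      set (x1 := X1 t s) in *; set (y1 := Y1 t s) in *; set (z1 := Z1 t s) in *.
      set (w1 := W1 t s) in *; set (D0 := D t s) in *.
      rewrite HD1W in Hx, Hy, Hz.
      (* If the projected velocity vanishes, tangency to the sphere forces [w1 = 0]; then the whole
         velocity in the sphere vanishes, although its squared length is [m^2 + n^2]. *)
      assert (Hw1 : w1 = 0).
      { assert (Hk : w1 * (sqrt 2 * D0) = 0).
        { replace (w1 * (sqrt 2 * D0)) with
            (x * (x1 * D0 - x * - w1) + y * (y1 * D0 - y * - w1) + z * (z1 * D0 - z * - w1)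
             - D0 * (x * x1 + y * y1 + z * z1 + w * w1)
             - w1 * (x * x + y * y + z * z + w * w) + w1 * (w * w + D0 * w + sqrt 2 * D0))
            by ring.
          rewrite Hx, Hy, Hz, Hor, Hs, HDW.
          replace (w * w + (sqrt 2 - w) * w + sqrt 2 * (sqrt 2 - w)) with (sqrt 2 * sqrt 2) by ring.
          rewrite E2; ring. }
        apply Rmult_integral in Hk; destruct Hk as [Hk|Hk]; [exact Hk |].
        pose proof (sqrt_lt_R0 2 ltac:(lra)); nra. }
      rewrite Hw1 in *.
      assert (Hz0 : forall a b, a * D0 - b * - 0 = 0 -> a = 0).
      { intros a b Hab; apply Rmult_eq_reg_r with D0; lra. }
      apply Hz0 in Hx; apply Hz0 in Hy; apply Hz0 in Hz; rewrite Hx, Hy, Hz in Hsp.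
      assert (0 < IZR m * IZR m) by (apply Rlt_0_sqr; exact Hm).
      pose proof (Rle_0_sqr (IZR n)); unfold Rsqr in *; lra.
    + intros s r Hx Hy Hz.
      assert (Hdiv : forall F : R -> R -> R, F t s / D t s = F t r / D t r ->
                     F t s * D t r = F t r * D t s).
      { intros F HF; replace (F t s) with (F t s / D t s * D t s) by (field; auto).
        rewrite HF; field; auto. }
      apply Hdiv in Hx; apply Hdiv in Hy; apply Hdiv in Hz.
      pose proof (Esph t s) as Hs; pose proof (Esph t r) as Hr.
      pose proof (HD t s) as Ds; pose proof (HD t r) as Dr.
      assert (HDs : W t s = sqrt 2 - D t s) by (unfold D; ring).
      assert (HDr : W t r = sqrt 2 - D t r) by (unfold D; ring).
      (* Injectivity of stereographic projection: the squared norm of the projected point is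
         [2 sqrt 2 / D - 1], so it determines [D]. *)
      assert (HDD : D t s = D t r).
      { rewrite HDs in Hs; rewrite HDr in Hr.
        assert (Hk : (2 - (sqrt 2 - D t s) * (sqrt 2 - D t s)) * (D t r * D t r) =
                     (2 - (sqrt 2 - D t r) * (sqrt 2 - D t r)) * (D t s * D t s)).
        { transitivity ((X t s * X t s + Y t s * Y t s + Z t s * Z t s) * (D t r * D t r));
            [f_equal; lra |].
          transitivity ((X t r * X t r + Y t r * Y t r + Z t r * Z t r) * (D t s * D t s));
            [|f_equal; lra].
          transitivity ((X t s * D t r) * (X t s * D t r) + (Y t s * D t r) * (Y t s * D t r) +
            (Z t s * D t r) * (Z t s * D t r)); [ring |].
          rewrite Hx, Hy, Hz; ring. }
        assert (Hk2 : D t s * D t r * (2 * sqrt 2) * (D t r - D t s) = 0).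
        { transitivity ((2 - (sqrt 2 - D t s) * (sqrt 2 - D t s)) * (D t r * D t r) -
                     (2 - (sqrt 2 - D t r) * (sqrt 2 - D t r)) * (D t s * D t s));
            [|rewrite Hk; ring].
          transitivity (D t s * D t r * (2 * sqrt 2) * (D t r - D t s) +
            (2 - sqrt 2 * sqrt 2) * (D t r * D t r - D t s * D t s)); [rewrite E2; ring | ring]. }
        apply Rmult_integral in Hk2; destruct Hk2 as [Hk2|Hk2]; [|lra].
        pose proof (sqrt_lt_R0 2 ltac:(lra)).
        assert (0 < D t s * D t r * (2 * sqrt 2)); [|lra].
        repeat apply Rmult_lt_0_compat; lra. }
      rewrite HDD in *; apply Rmult_eq_reg_r in Hx; [|auto]; apply Rmult_eq_reg_r in Hy; [|auto].
      apply Rmult_eq_reg_r in Hz; [|auto].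
      assert (HW : W t s = W t r) by lra.
      assert (Rc : forall u, c u = A t * X t u + B t * W t u /\ s1 u = A t * Y t u + B t * Z t u /\
        d u = A t * W t u - B t * X t u /\ s2 u = A t * Z t u - B t * Y t u).
      { intros u; unfold X, Y, Z, W, A'; repeat split;
        [transitivity ((A t * A t + B t * B t) * c u)
        |transitivity ((A t * A t + B t * B t) * s1 u)
        |transitivity ((A t * A t + B t * B t) * d u)
        |transitivity ((A t * A t + B t * B t) * s2 u)]; try ring; rewrite EAB; ring. }
      destruct (Rc s) as [U1 [U2 [U3 U4]]]; destruct (Rc r) as [V1 [V2 [V3 V4]]].
      rewrite Hx, HW in U1; rewrite Hy, Hz in U2; rewrite Hx, HW in U3; rewrite Hy, Hz in U4.
      destruct (cos_sin_eq (IZR m * s) (IZR m * r)) as [k Hk];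
        [unfold c in *; lra | unfold s1 in *; lra |].
      destruct (cos_sin_eq (IZR n * s + delta) (IZR n * r + delta)) as [j Hj];
        [unfold d in *; lra | unfold s2 in *; lra |].
      (* Both [m (s - r)] and [n (s - r)] are multiples of [2 PI]; a Bezout combination yields
         [s - r]. *)
      destruct (Z.gcd_bezout m n 1 hmn) as [p [q Hpq]].
      exists (p * k + q * j)%Z.
      assert (Hpq' : IZR p * IZR m + IZR q * IZR n = 1)
        by (rewrite <- !mult_IZR, <- plus_IZR; f_equal; exact Hpq).
      rewrite plus_IZR, !mult_IZR.
      replace (s - r) with ((IZR p * IZR m + IZR q * IZR n) * (s - r)) by (rewrite Hpq'; ring).
      transitivity (IZR p * (IZR m * s - IZR m * r) +
        IZR q * (IZR n * s + delta - (IZR n * r + delta))); [ring |].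
      rewrite Hk, Hj; ring.
Qed.

(** * Elastic rods as magnetic geodesics *)

(** The algebra of polynomials in the functions of [G]. It serves to bootstrap smoothness: along
    solutions of a polynomial differential system it is stable under derivation. *)
Inductive generated (G : (R -> R) -> Prop) : (R -> R) -> Prop :=
| generated_base f : G f -> generated G f
| generated_const c : generated G (fun _ => c)
| generated_plus f g : generated G f -> generated G g -> generated G (fun s => f s + g s)
| generated_mult f g : generated G f -> generated G g -> generated G (fun s => f s * g s).

Lemma generated_derive (G : (R -> R) -> Prop) :
  (forall f, G f -> exists f1, generated G f1 /\ forall s, is_derive f s (f1 s)) ->
  forall f, generated G f -> exists f1, generated G f1 /\ forall s, is_derive f s (f1 s).
Proof.
  intros HG f Hf; induction Hf as [f Hf|c|f g Hf IHf Hg IHg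
                                  |f g Hf IHf Hg IHg].
  - apply HG, Hf.
  - exists (fun _ => 0); split; [apply generated_const | intros s; apply (is_derive_const c)].
  - destruct IHf as [f1 [Gf Df]], IHg as [g1 [Gg Dg]]; exists (fun s => f1 s + g1 s).
    split; [apply generated_plus; assumption |].
    intros s; apply (is_derive_plus f g); auto.
  - destruct IHf as [f1 [Gf Df]], IHg as [g1 [Gg Dg]]; exists (fun s => f1 s * g s + f s * g1 s); split.
    + apply generated_plus; apply generated_mult; assumption.
    + intros s; apply is_derive_mul; auto.
Qed.

Lemma generated_ex_derive_n (G : (R -> R) -> Prop) :
  (forall f, G f -> exists f1, generated G f1 /\ forall s, is_derive f s (f1 s)) ->
  forall f, generated G f -> forall k s, ex_derive_n f k s.
Proof.
  intros HG f Hf.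
  assert (HD : forall k, exists g, generated G g /\ forall s, Derive_n f k s = g s).
  { induction k as [|k [g [Gg Eg]]]; [exists f; auto |].
    destruct (generated_derive G HG g Gg) as [g1 [Gg1 Dg]]; exists g1; split; [assumption |].
    intros s; cbn; rewrite (Derive_ext _ _ s Eg); apply is_derive_unique, Dg. }
  intros [|k] s; cbn; [exact I |].
  destruct (HD k) as [g [Gg Eg]]; destruct (generated_derive G HG g Gg) as [g1 [_ Dg]].
  apply ex_derive_ext with g; [intros t; symmetry; apply Eg | exists (g1 s); apply Dg].
Qed.

Lemma is_derive_ext_R (f g : R -> R) (s l : R) :
  (forall t, f t = g t) -> is_derive f s l -> is_derive g s l.
Proof. exact (is_derive_ext f g s l). Qed.

Lemma Derive3_mk3 (X Y Z X1 Y1 Z1 : R -> R) :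
  (forall s, is_derive X s (X1 s)) -> (forall s, is_derive Y s (Y1 s)) ->
  (forall s, is_derive Z s (Z1 s)) ->
  Derive3 (fun s => mk3 (X s) (Y s) (Z s)) = fun s => mk3 (X1 s) (Y1 s) (Z1 s).
Proof.
  intros HX HY HZ; apply functional_extensionality; intros s; unfold Derive3; cbn.
  change (fun t => X t) with X; change (fun t => Y t) with Y; change (fun t => Z t) with Z.
  rewrite (is_derive_unique _ _ _ (HX s)), (is_derive_unique _ _ _ (HY s)),
    (is_derive_unique _ _ _ (HZ s)); reflexivity.
Qed.

Lemma constant_of_derive_0 (f : R -> R) :
  (forall s, is_derive f s 0) -> forall s, f s = f 0.
Proof.
  intros Hf s; destruct (mean_value f (fun _ => 0) 0 s Hf) as [c [_ Hc]]; lra.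
Qed.

(* The hypotheses say T' = M x T with T = (X1, Y1, Z1) and
   M = (j Y, - j X, c); then M = a2 T + T x T', and the rod field is (0, 0, j). *)
Lemma magnetic_curve_is_rod (X Y Z X1 Y1 Z1 : R -> R) (j c : R) :
  (forall s, is_derive X s (X1 s)) -> (forall s, is_derive Y s (Y1 s)) ->
  (forall s, is_derive Z s (Z1 s)) ->
  (forall s, is_derive X1 s (- j * X s * Z1 s - c * Y1 s)) ->
  (forall s, is_derive Y1 s (c * X1 s - j * Y s * Z1 s)) ->
  (forall s, is_derive Z1 s (j * (X s * X1 s + Y s * Y1 s))) ->
  (forall s, X1 s * X1 s + Y1 s * Y1 s + Z1 s * Z1 s = 1) ->
  elastic_rod_centerline (fun s => mk3 (X s) (Y s) (Z s)).
Proof.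
  intros DX DY DZ DX1 DY1 DZ1 Hunit; split; [|split].
  - set (G := fun f : R -> R => f = X \/ f = Y \/ f = Z \/ f = X1 \/ f = Y1 \/ f = Z1).
    assert (GX : generated G X) by (apply generated_base; unfold G; auto 10).
    assert (GY : generated G Y) by (apply generated_base; unfold G; auto 10).
    assert (GZ : generated G Z) by (apply generated_base; unfold G; auto 10).
    assert (GX1 : generated G X1) by (apply generated_base; unfold G; auto 10).
    assert (GY1 : generated G Y1) by (apply generated_base; unfold G; auto 10).
    assert (GZ1 : generated G Z1) by (apply generated_base; unfold G; auto 10).
    assert (HG : forall f, G f -> exists f1, generated G f1 /\ forall s, is_derive f s (f1 s)).
    { intros f [-> | [-> | [-> | [-> | [-> | ->]]]]].
      - exists X1; auto.
      - exists Y1; auto.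
      - exists Z1; auto.
      - exists (fun s => - j * X s * Z1 s + - c * Y1 s); split.
        + repeat first [apply generated_plus | apply generated_mult | assumption
                       | apply (generated_const G)].
        + intros s; replace (_ + _) with (- j * X s * Z1 s - c * Y1 s) by ring; auto.
      - exists (fun s => c * X1 s + - j * Y s * Z1 s); split.
        + repeat first [apply generated_plus | apply generated_mult | assumption
                       | apply (generated_const G)].
        + intros s; replace (_ + _) with (c * X1 s - j * Y s * Z1 s) by ring; auto.
      - exists (fun s => j * (X s * X1 s + Y s * Y1 s)); split; [|auto].
        repeat first [apply generated_plus | apply generated_mult | assumption
                     | apply (generated_const G)]. }
    intros k s; cbn; repeat split; apply (generated_ex_derive_n G HG); assumption.
  - intros s; rewrite (Derive3_mk3 X Y Z X1 Y1 Z1 DX DY DZ); apply Hunit.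
  - set (fa2 := fun s => j * Y s * X1 s - j * X s * Y1 s + c * Z1 s).
    set (fa1 := fun s => j * j / 2 * (X s * X s + Y s * Y s) - j * Z1 s).
    assert (E2 : forall s, fa2 s = fa2 0).
    { apply constant_of_derive_0; intros s; unfold fa2.
      replace 0 with ((j * (Y1 s * X1 s + Y s * (- j * X s * Z1 s - c * Y1 s)) -
        j * (X1 s * Y1 s + X s * (c * X1 s - j * Y s * Z1 s))) +
        c * (j * (X s * X1 s + Y s * Y1 s))) by ring.
      apply (is_derive_plus (fun s => j * Y s * X1 s - j * X s * Y1 s) (fun s => c * Z1 s));
        [|apply (is_derive_scal Z1); auto].
      apply is_derive_ext_R with (fun s => j * (Y s * X1 s) - j * (X s * Y1 s)); [intros; ring |].
      apply (is_derive_minus (fun s => j * (Y s * X1 s)) (fun s => j * (X s * Y1 s)));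
        [apply (is_derive_scal (fun s => Y s * X1 s)) | apply (is_derive_scal (fun s => X s * Y1 s))];
        apply is_derive_mul; auto. }
    assert (E1 : forall s, fa1 s = fa1 0).
    { apply constant_of_derive_0; intros s; unfold fa1.
      replace 0 with (j * j / 2 * ((X1 s * X s + X s * X1 s) + (Y1 s * Y s + Y s * Y1 s)) -
        j * (j * (X s * X1 s + Y s * Y1 s))) by field.
      apply (is_derive_minus (fun s => j * j / 2 * (X s * X s + Y s * Y s)) (fun s => j * Z1 s));
        [|apply (is_derive_scal Z1); auto].
      apply (is_derive_scal (fun s => X s * X s + Y s * Y s)).
      apply (is_derive_plus (fun s => X s * X s) (fun s => Y s * Y s)); apply is_derive_mul; auto. }
    (* As [T' = M x T], one has [kappa^2 = |M|^2 - (M . T)^2]; the value of [a1] comes from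
       [J . T = kappa^2 / 2 - a1], where [J . T = j Z1]. *)
    exists (fa1 0 + c * c / 2 - fa2 0 * fa2 0 / 2), (fa2 0), (mk3 0 0 j); intros s.
    rewrite <- (E1 s), <- (E2 s).
    unfold rod_field; cbv zeta.
    rewrite (Derive3_mk3 X Y Z X1 Y1 Z1 DX DY DZ).
    rewrite (Derive3_mk3 X1 Y1 Z1 _ _ _ DX1 DY1 DZ1).
    assert (DX2 : forall s, is_derive (fun s => - j * X s * Z1 s - c * Y1 s) s
      (- j * (X1 s * Z1 s + X s * (j * (X s * X1 s + Y s * Y1 s))) -
       c * (c * X1 s - j * Y s * Z1 s))).
    { intros r; apply is_derive_ext_R with (fun s => - j * (X s * Z1 s) - c * Y1 s); [intros; ring |].
      apply (is_derive_minus (fun s => - j * (X s * Z1 s)) (fun s => c * Y1 s));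
        [apply (is_derive_scal (fun s => X s * Z1 s)), is_derive_mul
        |apply (is_derive_scal Y1)]; auto. }
    assert (DY2 : forall s, is_derive (fun s => c * X1 s - j * Y s * Z1 s) s
      (c * (- j * X s * Z1 s - c * Y1 s) -
       j * (Y1 s * Z1 s + Y s * (j * (X s * X1 s + Y s * Y1 s))))).
    { intros r; apply is_derive_ext_R with (fun s => c * X1 s - j * (Y s * Z1 s)); [intros; ring |].
      apply (is_derive_minus (fun s => c * X1 s) (fun s => j * (Y s * Z1 s)));
        [apply (is_derive_scal X1)
        |apply (is_derive_scal (fun s => Y s * Z1 s)), is_derive_mul]; auto. }
    assert (DZ2 : forall s, is_derive (fun s => j * (X s * X1 s + Y s * Y1 s)) s
      (j * ((X1 s * X1 s + X s * (- j * X s * Z1 s - c * Y1 s)) +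
            (Y1 s * Y1 s + Y s * (c * X1 s - j * Y s * Z1 s))))).
    { intros r; apply (is_derive_scal (fun s => X s * X1 s + Y s * Y1 s)).
      apply (is_derive_plus (fun s => X s * X1 s) (fun s => Y s * Y1 s));
        apply is_derive_mul; auto. }
    rewrite (Derive3_mk3 _ _ _ _ _ _ DX2 DY2 DZ2).
    pose proof (Hunit s) as Hu.
    unfold fa1, fa2; clear fa1 fa2 E1 E2.
    set (x := X s) in *; set (y := Y s) in *; set (x1 := X1 s) in *; set (y1 := Y1 s) in *;
    set (z1 := Z1 s) in *; clearbody x y x1 y1 z1.
    assert (Hz : z1 * z1 = 1 - x1 * x1 - y1 * y1) by lra.
    apply R3_eq; unfold add3, scal3, cross, dot; cbn [cx cy cz mk3 fst snd].
    all: field [Hz].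
Qed.

Lemma is_derive_value (f : R -> R) (s l l' : R) :
  is_derive f s l -> l = l' -> is_derive f s l'.
Proof. intros H <-; exact H. Qed.

Lemma is_derive_rescale (f : R -> R) (v s l : R) :
  is_derive f (s / v) l -> is_derive (fun t => f (t / v)) s (l / v).
Proof.
  intros Hf; replace (l / v) with (/ v * l) by (unfold Rdiv; ring).
  apply (is_derive_comp f (fun t => t / v)); [exact Hf |].
  apply is_derive_ext_R with (fun t => / v * t); [intros; unfold Rdiv; ring |].
  auto_derive; auto; ring.
Qed.

Lemma is_derive_rescale_div (f : R -> R) (v s l l' : R) :
  is_derive f (s / v) l -> l' = l / v / v -> is_derive (fun t => f (t / v) / v) s l'.
Proof.
  intros Hf ->.
  apply is_derive_ext_R with (fun t => / v * f (t / v)); [intros; unfold Rdiv; ring |].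
  replace (l / v / v) with (/ v * (l / v)) by (unfold Rdiv; ring).
  apply (is_derive_scal (fun t => f (t / v))), is_derive_rescale, Hf.
Qed.

(* In cylindrical coordinates: K is the logarithmic derivative of the distance
   to the axis and V the angular velocity. *)
Lemma rod_of_polar_system (X Y Z K V Z1 : R -> R) (om v : R) :
  0 < v ->
  (forall s, is_derive X s (K s * X s - V s * Y s)) ->
  (forall s, is_derive Y s (K s * Y s + V s * X s)) ->
  (forall s, is_derive Z s (Z1 s)) ->
  (forall s, is_derive K s (V s * V s - K s * K s - 2 * Z1 s - 2 * om * V s)) ->
  (forall s, is_derive V s (- 2 * K s * (V s - om))) ->
  (forall s, is_derive Z1 s (2 * K s * (X s * X s + Y s * Y s))) ->
  (forall s, (K s * K s + V s * V s) * (X s * X s + Y s * Y s) + Z1 s * Z1 s = v * v) ->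
  elastic_rod_centerline (fun s => mk3 (X (s / v)) (Y (s / v)) (Z (s / v))).
Proof.
  intros hv DX DY DZ DK DV DZ1 Hv.
  set (X1 := fun s => K s * X s - V s * Y s); set (Y1 := fun s => K s * Y s + V s * X s).
  assert (DX1 : forall s, is_derive X1 s (- 2 * X s * Z1 s - 2 * om * Y1 s)).
  { intros s; unfold Y1; replace (_ - _) with
      (((V s * V s - K s * K s - 2 * Z1 s - 2 * om * V s) * X s +
        K s * (K s * X s - V s * Y s)) - (- 2 * K s * (V s - om) * Y s +
        V s * (K s * Y s + V s * X s))) by ring.
    apply (is_derive_minus (fun s => K s * X s) (fun s => V s * Y s)); apply is_derive_mul; auto. }
  assert (DY1 : forall s, is_derive Y1 s (2 * om * X1 s - 2 * Y s * Z1 s)).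
  { intros s; unfold X1; replace (_ - _) with
      (((V s * V s - K s * K s - 2 * Z1 s - 2 * om * V s) * Y s +
        K s * (K s * Y s + V s * X s)) + (- 2 * K s * (V s - om) * X s +
        V s * (K s * X s - V s * Y s))) by ring.
    apply (is_derive_plus (fun s => K s * Y s) (fun s => V s * X s)); apply is_derive_mul; auto. }
  (* With respect to time [M] is [(2 Y, - 2 X, 2 om)]; passing to arc length divides it by the speed
     [v]. *)
  apply (magnetic_curve_is_rod (fun s => X (s / v)) (fun s => Y (s / v)) (fun s => Z (s / v))
    (fun s => X1 (s / v) / v) (fun s => Y1 (s / v) / v) (fun s => Z1 (s / v) / v)
    (2 / v) (2 * om / v)); intros s.
  - apply (is_derive_rescale X), DX.
  - apply (is_derive_rescale Y), DY.
  - apply (is_derive_rescale Z), DZ.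
  - eapply (is_derive_rescale_div X1); [apply DX1 | field; lra].
  - eapply (is_derive_rescale_div Y1); [apply DY1 | field; lra].
  - eapply (is_derive_rescale_div Z1); [apply DZ1 | unfold X1, Y1; field; lra].
  - transitivity (((K (s / v) * K (s / v) + V (s / v) * V (s / v)) *
      (X (s / v) * X (s / v) + Y (s / v) * Y (s / v)) + Z1 (s / v) * Z1 (s / v)) / (v * v)).
    + unfold X1, Y1; field; lra.
    + rewrite Hv; field; lra.
Qed.

(** The uniform lower bound on the derivative makes [f] onto R and its inverse Lipschitz; the
    difference quotients of the inverse are values of [/ f1] at points converging to [g s]. *)
Lemma inverse_function (f f1 : R -> R) (mu : R) :
  0 < mu -> (forall s, is_derive f s (f1 s)) -> (forall s, continuous f1 s) ->
  (forall s, mu <= f1 s) ->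
  exists g, (forall s, f (g s) = s) /\ (forall s, g (f s) = s) /\
            (forall s, is_derive g s (/ f1 (g s))).
Proof.
  intros hmu Df Cf Hmu.
  assert (Hlow : forall a b, a <= b -> mu * (b - a) <= f b - f a).
  { intros a b Hab; destruct (mean_value f f1 a b Df) as [c [_ ->]].
    pose proof (Hmu c); nra. }
  assert (Hcont : continuity f).
  { intros s; apply continuity_pt_filterlim, (ex_derive_continuous f); exists (f1 s); auto. }
  assert (Hsurj : forall y, exists s, f s = y).
  { intros y; set (b := (Rabs y + Rabs (f 0)) / mu).
    assert (Hb : mu * b = Rabs y + Rabs (f 0)) by (unfold b; field; lra).
    pose proof (Rabs_pos y); pose proof (Rabs_pos (f 0)).
    assert (0 <= b) by (apply Rmult_le_reg_l with mu; lra).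
    pose proof (Hlow 0 b ltac:(lra)); pose proof (Hlow (- b) 0 ltac:(lra)).
    assert (Hy : - Rabs y <= y <= Rabs y) by (unfold Rabs; destruct Rcase_abs; lra).
    assert (Hf0 : - Rabs (f 0) <= f 0 <= Rabs (f 0)) by (unfold Rabs; destruct Rcase_abs; lra).
    destruct (IVT_gen f (- b) b y Hcont) as [s [_ Hs]]; [|exists s; exact Hs].
    rewrite Rmin_left, Rmax_right by lra; lra. }
  destruct (choice _ Hsurj) as [g Hg]; exists g.
  assert (Hinj : forall a b, f a = f b -> a = b).
  { intros a b Hab; destruct (Rle_dec a b) as [H|H].
    - pose proof (Hlow a b H); nra.
    - pose proof (Hlow b a ltac:(lra)); nra. }
  split; [exact Hg | split; [intros s; apply Hinj, Hg |]].
  intros s; apply is_derive_Reals; intros eps Heps.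
  assert (Cinv : continuous (fun x => / f1 x) (g s)).
  { apply (continuous_comp f1 Rinv); [apply Cf |].
    apply continuous_of_derivable; auto_derive; pose proof (Hmu (g s)); lra. }
  destruct (continuous_Rabs_bound _ (g s) eps Heps Cinv) as [d Hd].
  assert (Hd' : 0 < d * mu) by (apply Rmult_lt_0_compat; [apply cond_pos | lra]).
  exists (mkposreal _ Hd'); cbn; intros h Hh0 Hh.
  destruct (mean_value f f1 (g s) (g (s + h)) Df) as [c [Hc E]]; rewrite !Hg in E.
  pose proof (Hmu c) as Hmc.
  assert (E' : g (s + h) - g s = / f1 c * h).
  { replace h with (s + h - s) at 2 by ring; rewrite E; field; lra. }
  replace ((g (s + h) - g s) / h) with (/ f1 c) by (rewrite E'; field; split; lra).
  apply Hd.
  assert (Hcg : Rabs (c - g s) <= Rabs (g (s + h) - g s)).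
  { revert Hc; unfold Rmin, Rmax, Rabs; repeat destruct Rle_dec; repeat destruct Rcase_abs; lra. }
  apply Rle_lt_trans with (1 := Hcg); rewrite E', Rabs_mult, Rabs_inv, (Rabs_pos_eq (f1 c)) by lra.
  apply Rmult_lt_reg_l with (f1 c); [lra |].
  rewrite <- Rmult_assoc, Rinv_r, Rmult_1_l by lra.
  apply Rlt_le_trans with (1 := Hh); pose proof (cond_pos d); nra.
Qed.

Lemma is_derive_primitive (f : R -> R) :
  (forall s, continuous f s) -> forall s, is_derive (RInt f 0) s (f s).
Proof.
  intros Cf s; apply (is_derive_RInt f (RInt f 0) 0); [|apply Cf].
  apply filter_forall; intros b.
  apply (RInt_correct f), (ex_RInt_continuous f); auto.
Qed.

Lemma primitive_odd (f : R -> R) :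
  (forall s, continuous f s) -> (forall s, f (- s) = f s) ->
  forall s, RInt f 0 (- s) = - RInt f 0 s.
Proof.
  intros Cf Ef s; pose proof (is_derive_primitive f Cf) as D.
  assert (H : RInt f 0 (- s) + RInt f 0 s = RInt f 0 (- 0) + RInt f 0 0).
  { apply (constant_of_derive_0 (fun s => RInt f 0 (- s) + RInt f 0 s)); intros t.
    apply is_derive_value with (- 1 * f (- t) + f t); [|rewrite Ef; ring].
    apply (is_derive_plus (fun t => RInt f 0 (- t)) (RInt f 0)); [|apply D].
    apply (is_derive_comp (RInt f 0) (fun t => - t)); [apply D | auto_derive; auto; ring]. }
  pose proof (RInt_point 0 f : RInt f 0 0 = 0) as H0; rewrite Ropp_0, H0 in H; lra.
Qed.

(** By evenness half a period carries half of the integral, so closing conditions may be imposed on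
    [[0, PI]]. *)
Lemma primitive_periodic (f : R -> R) :
  (forall s, continuous f s) -> (forall s, f (- s) = f s) ->
  (forall s, f (s + 2 * PI) = f s) ->
  forall s, RInt f 0 (s + 2 * PI) = RInt f 0 s + 2 * RInt f 0 PI.
Proof.
  intros Cf Ef Pf s; pose proof (is_derive_primitive f Cf) as D.
  assert (H : forall s, RInt f 0 (s + 2 * PI) - RInt f 0 s = RInt f 0 (0 + 2 * PI) - RInt f 0 0).
  { apply (constant_of_derive_0 (fun s => RInt f 0 (s + 2 * PI) - RInt f 0 s)); intros t.
    apply is_derive_value with (1 * f (t + 2 * PI) - f t); [|rewrite Pf; ring].
    apply (is_derive_minus (fun t => RInt f 0 (t + 2 * PI)) (RInt f 0)); [|apply D].
    apply (is_derive_comp (RInt f 0) (fun t => t + 2 * PI)); [apply D | auto_derive; auto]. }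
  pose proof (H s) as H1; pose proof (H (- PI)) as H2.
  rewrite (primitive_odd f Cf Ef) in H2; replace (- PI + 2 * PI) with PI in H2 by ring; lra.
Qed.

(** * Rods on tori of revolution *)

Lemma is_derive_comp_R (f g : R -> R) (s a b : R) :
  is_derive f (g s) a -> is_derive g s b -> is_derive (fun t => f (g t)) s (b * a).
Proof. apply (is_derive_comp f g). Qed.

(* [rod_u] is the squared distance to the axis. It satisfies a first order
   equation u'^2 = - 4 (u - (1 - e)) (u - (1 + e)) (u + sg); in terms of the
   phase s with u = 1 + e cos s this reads s' = 1 / rod_w. *)
Definition rod_u (e s : R) : R := 1 + e * cos s.
Definition rod_q (e sg s : R) : R := 1 + sg + e * cos s.
Definition rod_w (e sg s : R) : R := / (2 * sqrt (rod_q e sg s)).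

Lemma rod_u_pos (e s : R) : -1 < e < 1 -> 0 < rod_u e s.
Proof. intros He; unfold rod_u; pose proof (COS_bound s); destruct (Rle_dec 0 e); nra. Qed.

Lemma rod_q_pos (e sg s : R) : -1 < e < 1 -> 0 < sg -> 0 < rod_q e sg s.
Proof. intros He Hsg; pose proof (rod_u_pos e s He); unfold rod_u, rod_q in *; lra. Qed.

Lemma rod_w_pos (e sg s : R) : -1 < e < 1 -> 0 < sg -> 0 < rod_w e sg s.
Proof.
  intros He Hsg; apply Rinv_0_lt_compat, Rmult_lt_0_compat; [lra |].
  apply sqrt_lt_R0, rod_q_pos; assumption.
Qed.

Lemma rod_u_derivable (e s : R) : ex_derive (rod_u e) s.
Proof. unfold rod_u; auto_derive; auto. Qed.

Lemma rod_w_derivable (e sg s : R) : -1 < e < 1 -> 0 < sg -> ex_derive (rod_w e sg) s.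
Proof.
  intros He Hsg; pose proof (rod_q_pos e sg s He Hsg) as Hq; pose proof (sqrt_lt_R0 _ Hq).
  unfold rod_w, rod_q in *; auto_derive; repeat split; lra.
Qed.

(** In the frame rotating with velocity [om] the horizontal projection [w] satisfies
    [w'' = (2 beta - om^2 - 2 |w|^2) w]. With angular momentum [l] and energy [E], the squared
    distance [u] obeys [u'^2 = - 4 (u^3 - (2 beta - om^2) u^2 - 2 E u + l^2)]. The roots being
    [1 - e], [1 + e] and [- sg], their sum and product give the conditions on [om] and [l]. The
    height has velocity [u - beta] and the angle [om + l / u]; the two integrals are their
    increments over half a meridian turn. *)
Theorem rod_of_parameters (m n : Z) (e sg beta om l : R) :
  n <> 0%Z -> Z.gcd m n = 1%Z -> 0 < e < 1 -> 0 < sg ->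
  om * om = 2 * beta - 2 + sg -> l * l = (1 - e * e) * sg ->
  RInt (fun s => (rod_u e s - beta) * rod_w e sg s) 0 PI = 0 ->
  RInt (fun s => (om + l / rod_u e s) * rod_w e sg s) 0 PI = PI * (IZR m / IZR n) ->
  exists (gamma : R -> R3) (L : R) (rho z rho1 z1 theta theta1 : R -> R),
    simple_closed gamma L /\ elastic_rod_centerline gamma /\
    profile rho z rho1 z1 /\ winding (IZR m / IZR n) theta theta1 /\
    (forall p, image gamma p <-> image (cyl rho theta z) p).
Proof.
  intros hn hmn he hsg Hom Hl Hz0 Hth0; pose proof PI_RGT_0 as HPI.
  set (u := rod_u e) in *; set (q := rod_q e sg); set (w := rod_w e sg) in *.
  assert (Hu : forall s, 0 < u s) by (intros s; apply rod_u_pos; lra).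
  assert (Hu0 : forall s, u s <> 0) by (intros s; pose proof (Hu s); lra).
  assert (Hq : forall s, 0 < q s) by (intros s; apply rod_q_pos; lra).
  assert (Hsq : forall s, 0 < sqrt (q s)) by (intros s; apply sqrt_lt_R0, Hq).
  assert (Hsu : forall s, 0 < sqrt (u s)) by (intros s; apply sqrt_lt_R0, Hu).
  assert (Hw : forall s, 0 < w s) by (intros s; apply rod_w_pos; lra).
  assert (Hcos : forall s, cos (s + 2 * PI) = cos s)
    by (intros s; rewrite cos_plus, cos_2PI, sin_2PI; ring).
  assert (Pu : forall s, u (s + 2 * PI) = u s) by (intros s; unfold u, rod_u; rewrite Hcos; auto).
  assert (Pw : forall s, w (s + 2 * PI) = w s)
    by (intros s; unfold w, rod_w, rod_q; rewrite Hcos; auto).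
  assert (Eu : forall s, u (- s) = u s) by (intros s; unfold u, rod_u; rewrite cos_neg; auto).
  assert (Ew : forall s, w (- s) = w s)
    by (intros s; unfold w, rod_w, rod_q; rewrite cos_neg; auto).
  assert (Cw : forall s, ex_derive w s) by (intros s; apply rod_w_derivable; lra).
  assert (Cu : forall s, ex_derive u s) by (intros s; apply rod_u_derivable).
  set (z1 := fun s => (u s - beta) * w s) in *.
  set (theta1 := fun s => (om + l / u s) * w s) in *.
  assert (Cz1 : forall s, continuous z1 s).
  { intros s; apply continuous_of_derivable; unfold z1; auto_derive; repeat split; auto. }
  assert (Cth1 : forall s, continuous theta1 s).
  { intros s; apply continuous_of_derivable; unfold theta1; auto_derive; repeat split; auto. }
  assert (Ez1 : forall s, z1 (- s) = z1 s) by (intros s; unfold z1; rewrite Eu, Ew; auto).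
  assert (Eth1 : forall s, theta1 (- s) = theta1 s)
    by (intros s; unfold theta1; rewrite Eu, Ew; auto).
  assert (Pz1 : forall s, z1 (s + 2 * PI) = z1 s) by (intros s; unfold z1; rewrite Pu, Pw; auto).
  assert (Pth1 : forall s, theta1 (s + 2 * PI) = theta1 s)
    by (intros s; unfold theta1; rewrite Pu, Pw; auto).
  set (z := RInt z1 0 : R -> R); set (theta := RInt theta1 0 : R -> R); set (T := RInt w 0 : R -> R).
  set (rho := fun s => sqrt (u s)); set (rho1 := fun s => - e * sin s / (2 * sqrt (u s))).
  assert (Dz : forall s, is_derive z s (z1 s)) by (apply is_derive_primitive; auto).
  assert (Dth : forall s, is_derive theta s (theta1 s)) by (apply is_derive_primitive; auto).
  assert (DT : forall s, is_derive T s (w s))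
    by (apply is_derive_primitive; intros s; apply continuous_of_derivable, Cw).
  assert (Z0 : z 0 = 0) by exact (RInt_point 0 z1).
  assert (ZPI : z PI = 0) by exact Hz0.
  assert (Hudecr : forall s t, 0 <= s -> s < t -> t <= PI -> u t < u s).
  { intros s t H1 H2 H3; unfold u, rod_u.
    pose proof (cos_decreasing_1 s t ltac:(lra) ltac:(lra) ltac:(lra) ltac:(lra) H2); nra. }
  (* The sign of [z1] is that of [u - beta], and [u] decreases: [z] cannot fall to a value [<= 0]
     and then return to 0 at [PI]. *)
  assert (Zpos : forall s, 0 < s < PI -> 0 < z s).
  { intros s Hs; apply Rnot_le_lt; intros Hle.
    destruct (MVT_cor2 z z1 0 s ltac:(lra)) as [a [Ea Ha]]; [intros; apply is_derive_Reals, Dz |].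
    destruct (MVT_cor2 z z1 s PI ltac:(lra)) as [b [Eb Hb]]; [intros; apply is_derive_Reals, Dz |].
    rewrite Z0 in Ea; rewrite ZPI in Eb; unfold z1 in Ea, Eb.
    pose proof (Hudecr a b ltac:(lra) ltac:(lra) ltac:(lra)).
    pose proof (Hw a); pose proof (Hw b).
    assert (u a <= beta).
    { apply Rnot_lt_le; intros H2; assert (0 < (u a - beta) * w a * (s - 0)); [|lra].
      repeat apply Rmult_lt_0_compat; lra. }
    assert (beta <= u b); [|lra].
    apply Rnot_lt_le; intros H3; assert (0 < (beta - u b) * w b * (PI - s)); [|lra].
    repeat apply Rmult_lt_0_compat; lra. }
  (* These strict bounds give the signs of [z1] at 0 and [PI], and later a nonzero speed. *)
  assert (Hb : u PI < beta < u 0).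
  { pose proof (Zpos (PI / 2) ltac:(lra)) as Hz.
    destruct (MVT_cor2 z z1 0 (PI / 2) ltac:(lra)) as [a [Ea Ha]];
      [intros; apply is_derive_Reals, Dz |].
    destruct (MVT_cor2 z z1 (PI / 2) PI ltac:(lra)) as [b [Eb Hb]];
      [intros; apply is_derive_Reals, Dz |].
    rewrite Z0 in Ea; rewrite ZPI in Eb; unfold z1 in Ea, Eb.
    pose proof (Hudecr 0 a ltac:(lra) ltac:(lra) ltac:(lra)).
    pose proof (Hudecr b PI ltac:(lra) ltac:(lra) ltac:(lra)).
    pose proof (Hw a); pose proof (Hw b); split.
    - assert (u b < beta); [|lra]; apply Rnot_le_lt; intros H3.
      assert (0 <= (u b - beta) * w b * (PI - PI / 2)); [|lra].
      repeat apply Rmult_le_pos; lra.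
    - assert (beta < u a); [|lra]; apply Rnot_le_lt; intros H3.
      assert (0 <= (beta - u a) * w a * (PI / 2 - 0)); [|lra].
      repeat apply Rmult_le_pos; lra. }
  assert (Hprof : profile rho z rho1 z1).
  { split; auto.
    - intros s; unfold rho, rho1, u, rod_u; pose proof (Hu s); unfold u, rod_u in *.
      auto_derive; [lra |]; field; apply Rgt_not_eq, Hsu.
    - intros s; apply continuous_of_derivable; unfold rho1; pose proof (Hu s); pose proof (Hsu s).
      unfold u, rod_u in *; auto_derive; repeat split; lra.
    - intros s; unfold rho; rewrite Pu; auto.
    - intros s; unfold z; rewrite (primitive_periodic z1), Hz0 by assumption; ring.
    - intros s; unfold rho; rewrite Eu; auto.
    - intros s; apply (primitive_odd z1); assumption.
    - intros s Hs; unfold rho1; pose proof (sin_gt_0 s ltac:(lra) ltac:(lra)); pose proof (Hsu s).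
      assert (0 < e * sin s / (2 * sqrt (u s))) by (apply Rdiv_lt_0_compat; nra).
      unfold Rdiv in *; lra.
    - unfold z1; pose proof (Hw 0); nra.
    - unfold z1; pose proof (Hw PI); nra. }
  assert (Hwind : winding (IZR m / IZR n) theta theta1).
  { split; auto; intros s; unfold theta.
    rewrite (primitive_periodic theta1), Hth0 by assumption; ring. }
  (* [T] is the time as a function of the phase and [g] the phase as a function of time; the lower
     bound for [w] comes from [q s <= 2 + sg], as [e < 1]. *)
  destruct (inverse_function T w (/ (2 * sqrt (2 + sg)))) as [g [Tg [gT Dg]]]; auto.
  { apply Rinv_0_lt_compat, Rmult_lt_0_compat; [lra | apply sqrt_lt_R0; lra]. }
  { intros s; apply continuous_of_derivable, Cw. }
  { intros s; unfold w, rod_w; apply Rinv_le_contravar.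
    - apply Rmult_lt_0_compat; [lra | apply Hsq].
    - apply Rmult_le_compat_l; [lra |]; apply sqrt_le_1_alt.
      pose proof (COS_bound s); unfold rod_q; nra. }
  assert (Dg' : forall s, is_derive g s (2 * sqrt (q (g s)))).
  { intros s; apply is_derive_value with (1 := Dg s); unfold w, rod_w; fold (q (g s)).
    apply Rinv_inv. }
  clear Dg.
  set (X := fun s => rho (g s) * cos (theta (g s))).
  set (Y := fun s => rho (g s) * sin (theta (g s))).
  set (K := fun s => - e * sin (g s) * sqrt (q (g s)) / u (g s)).
  set (V := fun s => om + l / u (g s)).
  set (Z1 := fun s => u (g s) - beta).
  assert (Drho : forall s, is_derive (fun s => rho (g s)) s (K s * rho (g s))).
  { intros s; apply is_derive_value with (2 * sqrt (q (g s)) * rho1 (g s)).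
    - apply is_derive_comp_R; [apply Hprof | apply Dg'].
    - unfold K, rho1, rho; pose proof (Hsu (g s)); pose proof (sqrt_sqrt (u (g s))) as E.
      rewrite <- E at 2 by (left; apply Hu); field; lra. }
  assert (Dthg : forall s, is_derive (fun s => theta (g s)) s (V s)).
  { intros s; apply is_derive_value with (2 * sqrt (q (g s)) * theta1 (g s)).
    - apply is_derive_comp_R; auto.
    - unfold V, theta1, w, rod_w; fold (q (g s)); field; split; [auto | apply Rgt_not_eq, Hsq]. }
  assert (DX : forall s, is_derive X s (K s * X s - V s * Y s)).
  { intros s; apply is_derive_value with (K s * rho (g s) * cos (theta (g s)) +
      rho (g s) * - (V s * sin (theta (g s)))); [|unfold X, Y; ring].
    apply (is_derive_mul (fun s => rho (g s)) (fun s => cos (theta (g s)))); auto.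
    apply (is_derive_cos_comp (fun s => theta (g s))); auto. }
  assert (DY : forall s, is_derive Y s (K s * Y s + V s * X s)).
  { intros s; apply is_derive_value with (K s * rho (g s) * sin (theta (g s)) +
      rho (g s) * (V s * cos (theta (g s)))); [|unfold X, Y; ring].
    apply (is_derive_mul (fun s => rho (g s)) (fun s => sin (theta (g s)))); auto.
    apply (is_derive_sin_comp (fun s => theta (g s))); auto. }
  assert (DZ : forall s, is_derive (fun s => z (g s)) s (Z1 s)).
  { intros s; apply is_derive_value with (2 * sqrt (q (g s)) * z1 (g s)).
    - apply is_derive_comp_R; auto.
    - unfold Z1, z1, w, rod_w; fold (q (g s)); field; apply Rgt_not_eq, Hsq. }
  assert (HXY : forall s, X s * X s + Y s * Y s = u (g s)).
  { intros s; unfold X, Y, rho; pose proof (sin2_cos2 (theta (g s))) as E; unfold Rsqr in E.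
    transitivity (sqrt (u (g s)) * sqrt (u (g s)) *
      (sin (theta (g s)) * sin (theta (g s)) + cos (theta (g s)) * cos (theta (g s)))); [ring |].
    rewrite E, sqrt_sqrt by (left; apply Hu); ring. }
  assert (Halg : forall s, sqrt (q s) * sqrt (q s) = 1 + sg + e * cos s /\
    sin s * sin s = 1 - cos s * cos s).
  { intros s; pose proof (sin2_cos2 s); unfold Rsqr in *.
    rewrite sqrt_sqrt by (left; apply Hq); split; [reflexivity | lra]. }
  assert (DZ1 : forall s, is_derive Z1 s (2 * K s * (X s * X s + Y s * Y s))).
  { intros s; apply is_derive_value with (2 * sqrt (q (g s)) * (- e * sin (g s))).
    - apply (is_derive_comp_R (fun s => u s - beta)); [|auto].
      unfold u, rod_u; auto_derive; auto; ring.
    - rewrite HXY; unfold K; field; auto. }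
  assert (DV : forall s, is_derive V s (- 2 * K s * (V s - om))).
  { intros s; apply is_derive_value with
      (2 * sqrt (q (g s)) * (l * e * sin (g s) / (u (g s) * u (g s)))).
    - apply (is_derive_comp_R (fun s => om + l / u s)); [|auto].
      pose proof (Hu0 (g s)) as H; unfold u, rod_u in *; auto_derive; auto; field; auto.
    - unfold K, V; field; auto. }
  assert (DK : forall s, is_derive K s (V s * V s - K s * K s - 2 * Z1 s - 2 * om * V s)).
  { intros s; set (p := g s).
    apply is_derive_value with (2 * sqrt (q p) * (- e * cos p * sqrt (q p) / u p +
      e * e * (sin p * sin p) / (2 * sqrt (q p) * u p) -
      e * e * (sin p * sin p) * sqrt (q p) / (u p * u p))).
    - apply (is_derive_comp_R (fun s => - e * sin s * sqrt (q s) / u s)); [|apply Dg'].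
      fold p; pose proof (Hu0 p) as H; pose proof (Hq p) as H1; pose proof (Hsq p) as H2.
      unfold q, rod_q, u, rod_u in *; auto_derive; [repeat split; auto |].
      field; split; lra.
    - unfold V, K, Z1; fold p; destruct (Halg p) as [E1 E2].
      pose proof (Hu0 p) as H; pose proof (Hsq p) as H2.
      unfold u, rod_u in *; set (x := sqrt (q p)) in *; set (S := sin p) in *; set (C := cos p) in *.
      field [Hom Hl E1 E2]; split; lra. }
  (* Twice the energy in the rotating frame is [2 * sg - (1 - e * e)], by the pairwise products of
     the roots. Returning to the fixed frame adds [2 * om * l], the vertical motion adds
     [beta * beta], and the terms in [u] cancel. *)
  assert (Hspeed : forall s, (K s * K s + V s * V s) * (X s * X s + Y s * Y s) + Z1 s * Z1 s =
    2 * sg - (1 - e * e) + 2 * om * l + beta * beta).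
  { intros s; rewrite HXY; unfold V, K, Z1; set (p := g s); destruct (Halg p) as [E1 E2].
    pose proof (Hu0 p) as H; pose proof (Hsq p) as H2.
    unfold u, rod_u in *; set (x := sqrt (q p)) in *; set (S := sin p) in *; set (C := cos p) in *.
    field [Hom Hl E1 E2]; lra. }
  set (v2 := 2 * sg - (1 - e * e) + 2 * om * l + beta * beta) in *.
  (* At the outermost point the vertical velocity [u 0 - beta] is already nonzero. *)
  assert (Hv2 : 0 < v2).
  { rewrite <- (Hspeed (T 0)), HXY; unfold Z1; rewrite gT.
    assert (0 < (u 0 - beta) * (u 0 - beta)) by (apply Rmult_lt_0_compat; lra).
    assert (0 <= (K (T 0) * K (T 0) + V (T 0) * V (T 0)) * u 0); [|lra].
    apply Rmult_le_pos; [|left; apply Hu].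
    apply Rplus_le_le_0_compat; apply Rle_0_sqr. }
  set (v := sqrt v2).
  assert (Hv : 0 < v) by (apply sqrt_lt_R0, Hv2).
  assert (Hvv : v * v = v2) by (apply sqrt_sqrt; lra).
  assert (HTPI : 0 < T PI).
  { destruct (MVT_cor2 T w 0 PI ltac:(lra)) as [a [Ea Ha]]; [intros; apply is_derive_Reals, DT |].
    assert (T0 : T 0 = 0) by exact (RInt_point 0 w).
    rewrite T0 in Ea; pose proof (Hw a); nra. }
  assert (HTper : forall k s, T (s + IZR k * (2 * PI)) = T s + IZR k * (2 * T PI)).
  { intros k s; set (h := fun s => T s - T PI / PI * s).
    assert (Hh : h (s + IZR k * (2 * PI)) = h s).
    { apply (periodic_Z h); intros r; unfold h, T.
      rewrite (primitive_periodic w); auto; [|intros a; apply continuous_of_derivable, Cw].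
      field; lra. }
    unfold h in Hh.
    transitivity (T s - T PI / PI * s + T PI / PI * (s + IZR k * (2 * PI))); [lra | field; lra]. }
  set (N := IZR (Z.abs n)).
  assert (HN : 0 < N) by (apply IZR_lt; lia).
  (* The rod makes [N] meridian turns, each lasting [2 * T PI], at speed [v]. *)
  set (L := v * (N * (2 * T PI))).
  assert (HL : 0 < L) by (unfold L; repeat apply Rmult_lt_0_compat; lra).
  assert (Hgam : forall s, mk3 (X (s / v)) (Y (s / v)) (z (g (s / v))) =
                           cyl rho theta z (g (s / v))) by reflexivity.
  exists (fun s => mk3 (X (s / v)) (Y (s / v)) (z (g (s / v)))), L,
    rho, z, rho1, z1, theta, theta1.
  split; [split; [exact HL | split] |].
  - intros s.
    assert (Hg : g ((s + L) / v) = g (s / v) + N * (2 * PI)).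
    { rewrite <- (gT (g (s / v) + N * (2 * PI))); f_equal; unfold N; rewrite HTper, Tg.
      fold N; unfold L; field; lra. }
    unfold X, Y; rewrite Hg; unfold N.
    rewrite (winding_Z _ _ _ _ _ Hwind), (periodic_Z z (2 * PI) (profile_z_periodic _ _ _ _ Hprof)),
      (periodic_Z rho (2 * PI) (profile_rho_periodic _ _ _ _ Hprof)).
    assert (Hk : IZR m / IZR n * (IZR (Z.abs n) * (2 * PI)) = IZR (m * Z.sgn n) * (2 * PI)).
    { assert (Hs : IZR (Z.abs n) = IZR n * IZR (Z.sgn n)) by (rewrite <- mult_IZR; f_equal; lia).
      rewrite mult_IZR, Hs; field; apply not_0_IZR; exact hn. }
    rewrite Hk, cos_add_2PI, sin_add_2PI; reflexivity.
  - intros s t Hs Ht Hst.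
    assert (Hx := f_equal cx Hst); assert (Hy := f_equal cy Hst); assert (Hzz := f_equal cz Hst).
    cbn in Hx, Hy, Hzz.
    destruct (polar_coordinates_unique (rho (g (s / v))) (rho (g (t / v))) _ _ (Hsu _) (Hsu _) Hx Hy)
      as [Hr [j Hj]].
    destruct (profile_curve_injective m n _ _ _ _ _ _ _ _ j hn hmn Hprof Hwind Hr Hzz Hj) as [i Hi].
    assert (E : s / v - t / v = IZR i * N * (2 * T PI)).
    { rewrite <- (Tg (s / v)), <- (Tg (t / v)).
      replace (g (s / v)) with (g (t / v) + IZR (i * Z.abs n) * (2 * PI))
        by (rewrite mult_IZR; lra).
      rewrite HTper, mult_IZR; fold N; ring. }
    assert (E' : s - t = IZR i * L).
    { transitivity (v * (s / v - t / v)); [field; lra | rewrite E; unfold L; ring]. }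
    assert (Hi0 : i = 0%Z).
    { assert (H1 : (-1 < i < 1)%Z); [|lia].
      split; apply lt_IZR; apply Rmult_lt_reg_r with L; lra. }
    rewrite Hi0 in E'; lra.
  - split; [|split; [exact Hprof | split; [exact Hwind |]]].
    + apply (rod_of_polar_system X Y (fun s => z (g s)) K V Z1 om v); auto.
      intros s; rewrite Hvv; apply Hspeed.
    + apply image_reparametrization with (fun s => g (s / v)) (fun s => v * T s).
      * exact Hgam.
      * intros s; replace (v * T s / v) with (T s) by (field; lra); apply gT.
Qed.

(** * Solving the closure conditions *)

(** Uniform continuity along the segment over [x0] bounds the difference of the integrands; the last
    hypothesis makes the integrals at nearby parameters exist. *)
Lemma RInt_param_continuous (f : R -> R -> R) (a b x0 : R) :
  a < b -> (forall y, a <= y <= b -> continuity_2d_pt f x0 y) ->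
  locally x0 (fun x => forall y, a <= y <= b -> continuous (f x) y) ->
  continuous (fun x => RInt (f x) a b) x0.
Proof.
  intros Hab Hf [d Hd]; apply filterlim_locally; intros eps.
  assert (Heps : 0 < eps / (2 * (b - a))).
  { pose proof (cond_pos eps); apply Rdiv_lt_0_compat; lra. }
  destruct (uniform_continuity_2d_1d' f a b x0 Hf (mkposreal _ Heps)) as [eta H]; cbn in H.
  assert (Hm : 0 < Rmin d eta) by (apply Rmin_pos; apply cond_pos).
  exists (mkposreal _ Hm); intros x Hx.
  change (Rabs (x - x0) < Rmin d eta) in Hx; change (Rabs (RInt (f x) a b - RInt (f x0) a b) < eps).
  assert (Hex : forall x, Rabs (x - x0) < d -> ex_RInt (f x) a b).
  { intros y Hy; apply (ex_RInt_continuous (f y)); intros t Ht.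
    rewrite Rmin_left, Rmax_right in Ht by lra; exact (Hd y Hy t Ht). }
  assert (Ex : ex_RInt (f x) a b) by (apply Hex, (Rlt_le_trans _ _ _ Hx), Rmin_l).
  assert (Ex0 : ex_RInt (f x0) a b).
  { apply Hex; rewrite Rminus_diag_eq, Rabs_R0 by reflexivity; apply cond_pos. }
  rewrite <- (RInt_minus (f x) (f x0) a b Ex Ex0 : _ = RInt (f x) a b - RInt (f x0) a b).
  apply Rle_lt_trans with ((b - a) * (eps / (2 * (b - a)))).
  - apply abs_RInt_le_const; [lra | apply (ex_RInt_minus (f x) (f x0)); assumption |].
    intros t Ht; left; pose proof (cond_pos eta).
    assert (Hx' := Rlt_le_trans _ _ _ Hx (Rmin_r _ _)); apply Rabs_def2 in Hx'.
    apply H; rewrite ?Rminus_diag_eq, ?Rabs_R0 by reflexivity; lra.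
  - pose proof (cond_pos eps); replace ((b - a) * (eps / (2 * (b - a)))) with (eps / 2)
      by (field; lra); lra.
Qed.

(** Elliptic integrals over half a meridian turn. The quotient [rod_moment / rod_time] is the time
    average of the squared distance, which is the value of [beta] for which the height closes up. *)
Definition rod_time (e sg : R) : R := RInt (rod_w e sg) 0 PI.
Definition rod_moment (e sg : R) : R := RInt (fun s => rod_u e s * rod_w e sg s) 0 PI.
Definition rod_inverse_moment (e sg : R) : R := RInt (fun s => / rod_u e s * rod_w e sg s) 0 PI.

(* The angle around the axis swept by the rod over half a meridian period, when
   the mean height is constant. *)
Definition rod_angle (e sg : R) : R :=
  sqrt (2 * (rod_moment e sg / rod_time e sg) - 2 + sg) * rod_time e sg +
  sqrt ((1 - e * e) * sg) * rod_inverse_moment e sg.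

Lemma ex_RInt_derivable (f : R -> R) (a b : R) : (forall s, ex_derive f s) -> ex_RInt f a b.
Proof. intros Hf; apply (ex_RInt_continuous f); intros; apply continuous_of_derivable, Hf. Qed.

Lemma RInt_ext_R (f g : R -> R) (a b : R) :
  (forall s, f s = g s) -> RInt f a b = RInt g a b.
Proof. intros H; apply RInt_ext; intros s _; apply H. Qed.

Lemma rod_time_pos (e sg : R) : -1 < e < 1 -> 0 < sg -> 0 < rod_time e sg.
Proof.
  intros He Hsg; apply RInt_gt_0; [apply PI_RGT_0 | |].
  - intros; apply rod_w_pos; assumption.
  - intros; apply continuous_of_derivable, rod_w_derivable; assumption.
Qed.

Lemma rod_uw_derivable (e sg s : R) : -1 < e < 1 -> 0 < sg ->
  ex_derive (fun s => rod_u e s * rod_w e sg s) s.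
Proof.
  intros He Hsg; apply (ex_derive_mult (rod_u e) (rod_w e sg));
  [apply rod_u_derivable | apply rod_w_derivable; assumption].
Qed.

Lemma rod_wu_derivable (e sg s : R) : -1 < e < 1 -> 0 < sg ->
  ex_derive (fun s => / rod_u e s * rod_w e sg s) s.
Proof.
  intros He Hsg; apply (ex_derive_mult (fun s => / rod_u e s) (rod_w e sg));
  [|apply rod_w_derivable; assumption].
  apply ex_derive_inv; [apply rod_u_derivable |].
  apply Rgt_not_eq, rod_u_pos, He.
Qed.

Lemma rod_angle_continuous (al be : R -> R) (x0 : R) :
  continuous al x0 -> continuous be x0 -> -1 < al x0 < 1 -> 0 < be x0 ->
  continuous (fun x => rod_angle (al x) (be x)) x0.
Proof.
  intros Cal Cbe Hal Hbe; pose proof PI_RGT_0.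
  assert (Hloc : locally x0 (fun x => -1 < al x < 1 /\ 0 < be x)).
  { destruct (continuous_Rabs_bound al x0 (Rmin (1 - al x0) (1 + al x0))) as [d1 H1];
      [apply Rmin_pos; lra | exact Cal |].
    destruct (continuous_Rabs_bound be x0 (be x0) Hbe Cbe) as [d2 H2].
    assert (Hm : 0 < Rmin d1 d2) by (apply Rmin_pos; apply cond_pos).
    exists (mkposreal _ Hm); intros x Hx; change (Rabs (x - x0) < Rmin d1 d2) in Hx.
    assert (G1 := H1 x (Rlt_le_trans _ _ _ Hx (Rmin_l _ _))).
    assert (G2 := H2 x (Rlt_le_trans _ _ _ Hx (Rmin_r _ _))).
    pose proof (Rmin_l (1 - al x0) (1 + al x0)); pose proof (Rmin_r (1 - al x0) (1 + al x0)).
    apply Rabs_def2 in G1; apply Rabs_def2 in G2; lra. }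
  assert (Ccos : forall s, continuity_2d_pt (fun _ v => cos v) x0 s).
  { intros s; apply continuity_2d_cos, continuity_2d_pt_id2. }
  assert (C1 : forall (f : R -> R) s, continuous f x0 -> continuity_2d_pt (fun x _ => f x) x0 s).
  { intros f s Cf; apply (continuity_1d_2d_pt_comp f (fun x _ => x));
    [apply continuity_pt_filterlim, Cf | apply continuity_2d_pt_id1]. }
  assert (Cu : forall s, continuity_2d_pt (fun x v => rod_u (al x) v) x0 s).
  { intros s; unfold rod_u; apply continuity_2d_pt_plus; [apply continuity_2d_pt_const |].
    apply continuity_2d_pt_mult; auto. }
  assert (Cw : forall s, continuity_2d_pt (fun x v => rod_w (al x) (be x) v) x0 s).
  { intros s; apply (continuity_1d_2d_pt_comp (fun t => / (2 * sqrt t))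
      (fun x v => rod_q (al x) (be x) v)).
    - apply continuity_pt_filterlim, (continuous_of_derivable (fun t => / (2 * sqrt t))).
      pose proof (rod_q_pos (al x0) (be x0) s Hal Hbe) as Hq.
      set (y := rod_q (al x0) (be x0) s) in *; clearbody y; pose proof (sqrt_lt_R0 y Hq).
      auto_derive; repeat split; lra.
    - unfold rod_q; apply continuity_2d_pt_plus; [apply continuity_2d_pt_plus; auto |].
      + apply continuity_2d_pt_const.
      + apply continuity_2d_pt_mult; auto. }
  assert (CA : continuous (fun x => rod_time (al x) (be x)) x0).
  { apply (RInt_param_continuous (fun x => rod_w (al x) (be x))); auto.
    revert Hloc; apply filter_imp; intros x [Hx Hx'] y _.
    apply continuous_of_derivable, rod_w_derivable; assumption. }
  assert (CB : continuous (fun x => rod_moment (al x) (be x)) x0).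
  { apply (RInt_param_continuous (fun x s => rod_u (al x) s * rod_w (al x) (be x) s)); auto.
    - intros y _; apply continuity_2d_pt_mult; auto.
    - revert Hloc; apply filter_imp; intros x [Hx Hx'] y _.
      apply continuous_of_derivable, rod_uw_derivable; assumption. }
  assert (CC : continuous (fun x => rod_inverse_moment (al x) (be x)) x0).
  { apply (RInt_param_continuous (fun x s => / rod_u (al x) s * rod_w (al x) (be x) s)); auto.
    - intros y _; apply continuity_2d_pt_mult; auto.
      apply continuity_2d_pt_inv; [auto | apply Rgt_not_eq, rod_u_pos, Hal].
    - revert Hloc; apply filter_imp; intros x [Hx Hx'] y _.
      apply continuous_of_derivable, rod_wu_derivable; assumption. }
  assert (HA : rod_time (al x0) (be x0) <> 0) by (apply Rgt_not_eq, rod_time_pos; assumption).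
  assert (Cm : forall f g : R -> R, continuous f x0 -> continuous g x0 ->
    continuous (fun x => f x * g x) x0) by (intros f g; apply (continuous_mult f g)).
  assert (Cp : forall f g : R -> R, continuous f x0 -> continuous g x0 ->
    continuous (fun x => f x + g x) x0) by (intros f g; apply (continuous_plus f g)).
  (* The total function [sqrt] is 0 on negative numbers and continuous everywhere; the sign of the
     radicands is a separate matter, for which [rod_mean_bound] is used. *)
  assert (Cs : forall f : R -> R, continuous f x0 -> continuous (fun x => sqrt (f x)) x0).
  { intros f Cf; apply (continuous_comp f sqrt); [exact Cf | apply continuous_sqrt]. }
  unfold rod_angle; apply Cp; apply Cm; auto; apply Cs.
  - apply Cp; [apply Cp |]; auto; [|apply continuous_const].
    apply Cm; [apply continuous_const |]; apply Cm; auto.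
    apply (continuous_comp (fun x => rod_time (al x) (be x)) Rinv); [exact CA |].
    apply continuous_of_derivable; auto_derive; exact HA.
  - apply Cm; auto; apply Cp; [apply continuous_const |].
    apply (continuous_opp (fun x => al x * al x)); apply Cm; auto.
Qed.

(** At [e = 0] the rod is a circle and all integrands are constant. The value is the limit of the
    swept angle for small meridian oscillations. *)
Lemma rod_angle_0 (sg : R) : 0 < sg -> rod_angle 0 sg = PI * (sqrt sg / sqrt (1 + sg)).
Proof.
  intros Hsg; pose proof PI_RGT_0; pose proof (sqrt_lt_R0 (1 + sg) ltac:(lra)) as Hs.
  assert (Hint : forall (f : R -> R) c, (forall s, f s = c) -> RInt f 0 PI = PI * c).
  { intros f c Hf; rewrite (RInt_ext_R f (fun _ => c) 0 PI Hf).
    rewrite RInt_const; unfold scal; cbn; unfold mult; cbn; ring. }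
  assert (Eu : forall s, rod_u 0 s = 1) by (intros s; unfold rod_u; ring).
  assert (Ew : forall s, rod_w 0 sg s = / (2 * sqrt (1 + sg))).
  { intros s; unfold rod_w, rod_q; rewrite Rmult_0_l, Rplus_0_r; reflexivity. }
  assert (EA : rod_time 0 sg = PI * / (2 * sqrt (1 + sg))) by (apply Hint, Ew).
  assert (EB : rod_moment 0 sg = PI * / (2 * sqrt (1 + sg)))
    by (apply Hint; intros s; rewrite Eu, Ew; ring).
  assert (EC : rod_inverse_moment 0 sg = PI * / (2 * sqrt (1 + sg)))
    by (apply Hint; intros s; rewrite Eu, Ew, Rinv_1; ring).
  unfold rod_angle; rewrite EA, EB, EC.
  replace (2 * (PI * / (2 * sqrt (1 + sg)) / (PI * / (2 * sqrt (1 + sg)))) - 2 + sg) with sg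
    by (field; split; lra).
  replace ((1 - 0 * 0) * sg) with sg by ring; field; lra.
Qed.

(** An average of [rod_u] is at least its minimum. With [2 * e <= sg] this makes [2 * beta - 2 + sg]
    nonnegative, so that it is a genuine square [om * om]. *)
Lemma rod_mean_bound (e sg : R) : 0 <= e < 1 -> 0 < sg -> 1 - e <= rod_moment e sg / rod_time e sg.
Proof.
  intros He Hsg; pose proof PI_RGT_0; pose proof (rod_time_pos e sg ltac:(lra) Hsg) as HA.
  apply Rmult_le_reg_r with (rod_time e sg); [exact HA |].
  replace (rod_moment e sg / rod_time e sg * rod_time e sg) with (rod_moment e sg) by (field; lra).
  assert (Iw : ex_RInt (rod_w e sg) 0 PI)
    by (apply ex_RInt_derivable; intros s; apply rod_w_derivable; lra).
  replace ((1 - e) * rod_time e sg) with (RInt (fun s => (1 - e) * rod_w e sg s) 0 PI)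
    by (apply (RInt_scal (rod_w e sg)), Iw).
  apply RInt_le; [lra | apply (ex_RInt_scal (rod_w e sg)), Iw | |].
  - apply ex_RInt_derivable; intros s; apply rod_uw_derivable; lra.
  - intros s _; apply Rmult_le_compat_r; [left; apply rod_w_pos; lra |].
    unfold rod_u; pose proof (COS_bound s); nra.
Qed.

(** For [e = 0] the solution is [sg0 = x^2 / (1 - x^2)], but it only gives a circle. The strict
    inequalities at [sg0 / 2] and [2 * sg0] persist for small [e > 0], and the intermediate value
    theorem is applied in [sg] with this [e] fixed. *)
Lemma exists_rod_angle (x : R) :
  0 < x < 1 -> exists e sg, 0 < e < 1 /\ 0 < sg /\ 2 * e <= sg /\ rod_angle e sg = PI * x.
Proof.
  intros Hx; pose proof PI_RGT_0.
  set (sg0 := x * x / (1 - x * x)).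
  assert (Hx2 : 0 < x * x < 1) by nra.
  assert (Hsg0 : 0 < sg0) by (apply Rdiv_lt_0_compat; lra).
  assert (E0 : sg0 * (1 - x * x) = x * x) by (unfold sg0; field; lra).
  assert (Hlow : rod_angle 0 (sg0 / 2) < PI * x).
  { rewrite rod_angle_0 by lra; apply Rmult_lt_compat_l; [lra |].
    rewrite <- sqrt_div_alt by lra; rewrite <- (sqrt_square x) by lra.
    apply sqrt_lt_1_alt; split; [apply Rdiv_le_0_compat; lra |].
    apply Rmult_lt_reg_r with (1 + sg0 / 2); [lra |].
    replace (sg0 / 2 / (1 + sg0 / 2) * (1 + sg0 / 2)) with (sg0 / 2) by (field; lra); nra. }
  assert (Hhigh : PI * x < rod_angle 0 (2 * sg0)).
  { rewrite rod_angle_0 by lra; apply Rmult_lt_compat_l; [lra |].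
    rewrite <- sqrt_div_alt by lra; rewrite <- (sqrt_square x) at 1 by lra.
    apply sqrt_lt_1_alt; split; [nra |].
    apply Rmult_lt_reg_r with (1 + 2 * sg0); [lra |].
    replace (2 * sg0 / (1 + 2 * sg0) * (1 + 2 * sg0)) with (2 * sg0) by (field; lra); nra. }
  assert (Cid : forall y : R, continuous (fun t : R => t) y) by (intros; apply continuous_id).
  assert (C0 : forall sg, 0 < sg -> continuous (fun e => rod_angle e sg) 0).
  { intros sg Hsg; apply (rod_angle_continuous (fun t => t) (fun _ => sg)); auto; [|lra].
    apply continuous_const. }
  destruct (continuous_Rabs_bound _ 0 (PI * x - rod_angle 0 (sg0 / 2)) ltac:(lra)
    (C0 (sg0 / 2) ltac:(lra))) as [d1 H1].
  destruct (continuous_Rabs_bound _ 0 (rod_angle 0 (2 * sg0) - PI * x) ltac:(lra)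
    (C0 (2 * sg0) ltac:(lra))) as [d2 H2].
  (* The term [sg0 / 2] yields [2 * e <= sg0 / 2 <= sg]; the final halving makes the other bounds
     strict. *)
  set (e := Rmin (Rmin d1 d2) (Rmin 1 (sg0 / 2)) / 2).
  assert (He : 0 < Rmin (Rmin d1 d2) (Rmin 1 (sg0 / 2))).
  { repeat apply Rmin_pos; try apply cond_pos; lra. }
  assert (He1 : 0 < e /\ e < d1 /\ e < d2 /\ e < 1 /\ 4 * e <= sg0).
  { pose proof (Rmin_l (Rmin d1 d2) (Rmin 1 (sg0 / 2)));
    pose proof (Rmin_r (Rmin d1 d2) (Rmin 1 (sg0 / 2)));
    pose proof (Rmin_l d1 d2); pose proof (Rmin_r d1 d2);
    pose proof (Rmin_l 1 (sg0 / 2)); pose proof (Rmin_r 1 (sg0 / 2)); unfold e; lra. }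
  clearbody e; destruct He1 as [He0 [Hed1 [Hed2 [He11 Hesg]]]].
  assert (G1 : Rabs (e - 0) < d1) by (rewrite Rminus_0_r, Rabs_pos_eq; lra).
  assert (G2 : Rabs (e - 0) < d2) by (rewrite Rminus_0_r, Rabs_pos_eq; lra).
  apply H1 in G1; apply H2 in G2; apply Rabs_def2 in G1; apply Rabs_def2 in G2.
  destruct (Ranalysis5.IVT_interv (fun sg => rod_angle e sg - PI * x) (sg0 / 2) (2 * sg0))
    as [sg [Hsg Esg]]; [|lra | lra | lra |].
  - intros sg Hsg; apply continuity_pt_minus; [|apply continuity_pt_const; intros y z; reflexivity].
    apply continuity_pt_filterlim.
    apply (rod_angle_continuous (fun _ => e) (fun t => t)); auto; [apply continuous_const | lra | lra].
  - exists e, sg; repeat split; lra.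
Qed.

Lemma exists_rod_parameters (x : R) :
  x <> 0 -> -1 < x < 1 ->
  exists e sg beta om l,
    0 < e < 1 /\ 0 < sg /\ om * om = 2 * beta - 2 + sg /\ l * l = (1 - e * e) * sg /\
    RInt (fun s => (rod_u e s - beta) * rod_w e sg s) 0 PI = 0 /\
    RInt (fun s => (om + l / rod_u e s) * rod_w e sg s) 0 PI = PI * x.
Proof.
  intros Hx0 Hx.
  assert (Hx' : 0 < Rabs x < 1).
  { split; [apply Rabs_pos_lt, Hx0 | apply Rabs_def1; lra]. }
  destruct (exists_rod_angle (Rabs x) Hx') as [e [sg [He [Hsg [Hesg Hang]]]]].
  set (beta := rod_moment e sg / rod_time e sg).
  (* Changing the signs of [om] and [l] together reflects the rod in a plane through the axis: the
     swept angle changes sign, the squares stay. *)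
  assert (Hsgn : exists c, c * c = 1 /\ c * Rabs x = x).
  { destruct (Rcase_abs x) as [Hneg|Hpos].
    - exists (-1); rewrite Rabs_left by lra; split; ring.
    - exists 1; rewrite Rabs_right by lra; split; ring. }
  destruct Hsgn as [c [Hc Hcx]].
  pose proof (rod_mean_bound e sg ltac:(lra) Hsg) as Hbeta; fold beta in Hbeta.
  pose proof (rod_time_pos e sg ltac:(lra) Hsg) as HA.
  set (om := sqrt (2 * beta - 2 + sg)); set (l := sqrt ((1 - e * e) * sg)).
  assert (Hom : om * om = 2 * beta - 2 + sg) by (apply sqrt_sqrt; lra).
  assert (Hl : l * l = (1 - e * e) * sg) by (apply sqrt_sqrt; apply Rmult_le_pos; nra).
  assert (IA : ex_RInt (rod_w e sg) 0 PI)
    by (apply ex_RInt_derivable; intros s; apply rod_w_derivable; lra).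
  assert (IB : ex_RInt (fun s => rod_u e s * rod_w e sg s) 0 PI)
    by (apply ex_RInt_derivable; intros s; apply rod_uw_derivable; lra).
  assert (IC : ex_RInt (fun s => / rod_u e s * rod_w e sg s) 0 PI)
    by (apply ex_RInt_derivable; intros s; apply rod_wu_derivable; lra).
  assert (Hlin : forall (f g : R -> R) k j, ex_RInt f 0 PI -> ex_RInt g 0 PI ->
    RInt (fun s => k * f s + j * g s) 0 PI = k * RInt f 0 PI + j * RInt g 0 PI).
  { intros f g k j Hf Hg.
    apply is_RInt_unique, (is_RInt_plus (fun s => k * f s) (fun s => j * g s));
    [apply (is_RInt_scal f) | apply (is_RInt_scal g)];
    apply (RInt_correct (V := R_CompleteNormedModule)); assumption. }
  exists e, sg, beta, (c * om), (c * l); split; [exact He | split; [exact Hsg |]].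
  split; [|split; [|split]].
  - rewrite <- Hom; transitivity (c * c * (om * om)); [ring | rewrite Hc; ring].
  - rewrite <- Hl; transitivity (c * c * (l * l)); [ring | rewrite Hc; ring].
  - rewrite (RInt_ext_R _ (fun s => 1 * (rod_u e s * rod_w e sg s) + - beta * rod_w e sg s))
      by (intros; ring).
    rewrite Hlin by assumption; fold (rod_time e sg); fold (rod_moment e sg).
    match goal with |- ?a = ?b => change (@eq R a b) end; unfold beta; field; lra.
  - rewrite (RInt_ext_R _ (fun s => c * om * rod_w e sg s + c * l * (/ rod_u e s * rod_w e sg s)))
      by (intros; unfold Rdiv; ring).
    rewrite Hlin by assumption; fold (rod_time e sg); fold (rod_inverse_moment e sg).
    match goal with |- ?a = ?b => change (@eq R a b) end.
    transitivity (c * rod_angle e sg); [unfold rod_angle, om, l, beta; ring |].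
    rewrite Hang; transitivity (PI * (c * Rabs x)); [ring | rewrite Hcx; reflexivity].
Qed.

(** The slope [m / n] lies in the range of swept angles of rods. The rod found there comes with a
    profile and an angle function of this same slope, so it can be joined to the given curve. *)
Theorem elastic_rod_of_winding (m n : Z) (rho z rho1 z1 theta theta1 : R -> R) :
  m <> 0%Z -> (Z.abs m < Z.abs n)%Z -> Z.gcd m n = 1%Z ->
  profile rho z rho1 z1 -> winding (IZR m / IZR n) theta theta1 ->
  exists (gamma : R -> R3) (L : R),
    simple_closed gamma L /\ elastic_rod_centerline gamma /\
    same_knot_type (image (cyl rho theta z)) (image gamma).
Proof.
  intros hm hlt hmn Hp Hw.
  assert (hn : n <> 0%Z) by lia.
  assert (Hm : IZR m <> 0) by (apply not_0_IZR; exact hm).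
  assert (Hn : 0 < Rabs (IZR n)) by (apply Rabs_pos_lt, not_0_IZR; exact hn).
  assert (Hn0 : IZR n <> 0) by (apply not_0_IZR; exact hn).
  assert (Hx : -1 < IZR m / IZR n < 1).
  { apply Rabs_lt_between; unfold Rdiv; rewrite Rabs_mult, Rabs_inv.
    apply Rmult_lt_reg_r with (Rabs (IZR n)); [exact Hn |].
    rewrite Rmult_assoc, Rinv_l, Rmult_1_r, Rmult_1_l by lra.
    rewrite <- !abs_IZR; apply IZR_lt, hlt. }
  destruct (exists_rod_parameters (IZR m / IZR n)) as [e [sg [beta [om [l [He [Hsg [H1 [H2 [H3 H4]]]]]]]]]].
  { unfold Rdiv; apply Rmult_integral_contrapositive; split; [exact Hm | apply Rinv_neq_0_compat, Hn0]. }
  { exact Hx. }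
  destruct (rod_of_parameters m n e sg beta om l hn hmn He Hsg H1 H2 H3 H4)
    as [gamma [L [r [y [r1 [y1 [th [th1 [Hc [Hr [Hp' [Hw' Him]]]]]]]]]]]].
  exists gamma, L; split; [exact Hc | split; [exact Hr |]].
  apply same_knot_type_ext with (image (cyl rho theta z)) (image (cyl r th y)).
  - reflexivity.
  - intros p; symmetry; apply Him.
  - exact (same_knot_type_profile m n _ _ _ _ _ _ _ _ _ _ _ _ hn hmn Hp Hp' Hw Hw').
Qed.

Theorem theorem1 (m n : Z) (hm : m <> 0%Z) (hn : n <> 0%Z)
    (hmn : Z.gcd m n = 1%Z) (a r : R) (hr : 0 < r) (hra : r < a) :
  exists (gamma : R -> R3) (L : R),
    simple_closed gamma L /\
    elastic_rod_centerline gamma /\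
    same_knot_type (image (torus_curve a r m n)) (image gamma).
Proof.
  assert (Hpass : forall K : R3 -> Prop,
    same_knot_type (image (cyl (fun s => a + r * cos s) (fun s => IZR m / IZR n * s + 0)
      (fun s => r * sin s))) K ->
    (exists (gamma : R -> R3) (L : R),
      simple_closed gamma L /\ elastic_rod_centerline gamma /\ same_knot_type K (image gamma)) ->
    exists (gamma : R -> R3) (L : R), simple_closed gamma L /\ elastic_rod_centerline gamma /\
      same_knot_type (image (torus_curve a r m n)) (image gamma)).
  { intros K HK [gamma [L [Hc [Hr Hs]]]]; exists gamma, L; split; [exact Hc | split; [exact Hr |]].
    apply same_knot_type_ext with
      (image (cyl (fun s => a + r * cos s) (fun s => IZR m / IZR n * s + 0) (fun s => r * sin s)))
      (image gamma).
    - intros p; symmetry; apply torus_curve_image, hn.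
    - reflexivity.
    - exact (same_knot_type_trans _ _ _ HK Hs). }
  destruct (Z.lt_total (Z.abs m) (Z.abs n)) as [Hlt|[Heq|Hgt]].
  - eapply Hpass; [apply same_knot_type_refl |].
    exact (elastic_rod_of_winding m n _ _ _ _ _ _ hm Hlt hmn (profile_circle a r hr hra)
      (winding_affine _ 0)).
  (* Coprimality leaves only [|m| = |n| = 1], where [m / n = m n]. Doubling the number of meridian
     turns replaces this slope by [m n / 2], which a rod can have. *)
  - assert (Hm1 : Z.abs m = 1%Z).
    { rewrite <- hmn; destruct (Z.abs_eq_cases m n Heq) as [-> | ->].
      - symmetry; apply Z.gcd_diag.
      - rewrite Z.gcd_opp_l, Z.gcd_diag; lia. }
    assert (Hmn1 : Z.abs (m * n) = 1%Z) by (rewrite Z.abs_mul; lia).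
    assert (Hnn : IZR n * IZR n = 1) by (rewrite <- mult_IZR; f_equal; nia).
    assert (Hn0 : IZR n <> 0) by (apply not_0_IZR; exact hn).
    eapply Hpass.
    + replace (IZR m / IZR n) with (IZR (m * n) / 1).
      * exact (same_knot_type_longitude (m * n) a r Hmn1 hr hra).
      * rewrite mult_IZR; field_simplify_eq; [|exact Hn0].
        transitivity (IZR m * (IZR n * IZR n)); [ring | rewrite Hnn; ring].
    + apply (elastic_rod_of_winding (m * n) 2 _ _ _ _ _ _ ltac:(lia) ltac:(lia)
        ltac:(assert (m * n = 1 \/ m * n = -1)%Z as [-> | ->] by lia; reflexivity)
        (profile_circle a r hr hra) (winding_affine _ 0)).
  (* The given torus is first deformed into the projected Clifford torus, on which the exchange
     takes place; after it the slope is [n / m]. *)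
  - destruct (same_knot_type_swap m n hm hn hmn) as [c1 [c2 Hswap]].
    eapply Hpass.
    + apply same_knot_type_trans with (2 := Hswap).
      exact (same_knot_type_profile m n _ _ _ _ _ _ _ _ _ _ _ _ hn hmn
        (profile_circle a r hr hra) profile_clifford (winding_affine _ 0) (winding_affine _ c1)).
    + rewrite Z.gcd_comm in hmn.
      exact (elastic_rod_of_winding n m _ _ _ _ _ _ hn ltac:(lia) hmn profile_clifford
        (winding_affine _ c2)).
Qed.
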